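(* Let $\alpha,\beta,\gamma>-1$, $a<0$, and let $n\in\mathbb{N}$ with $n\ge 2$. Then: (i) $x(x-a)P_{n-1}^{(\alpha+1,\beta+1,\gamma+1)}(x;a)\prec P_n^{(\alpha+1,\beta,\gamma)}(x;a)$ and $P_n^{(\alpha+1,\beta,\gamma)}(x;a)\prec P_n^{(\alpha,\beta,\gamma)}(x;a)$; (ii) $P_n^{(\alpha,\beta,\gamma)}(x;a)\prec P_n^{(\alpha,\beta+1,\gamma)}(x;a)$ and $P_n^{(\alpha,\beta+1,\gamma)}(x;a)\prec x(x-1)P_{n-1}^{(\alpha+1,\beta+1,\gamma+1)}(x;a)$; (iii) on $(a,0)$: $P_n^{(\alpha,\beta,\gamma+1)}(x;a)\prec P_n^{(\alpha,\beta,\gamma)}(x;a)$ and $P_n^{(\alpha,\beta,\gamma)}(x;a)\prec P_{n-1}^{(\alpha+1,\beta+1,\gamma+1)}(x;a)$; on $(0,1)$: $P_n^{(\alpha,\beta,\gamma)}(x;a)\prec P_n^{(\alpha,\beta,\gamma+1)}(x;a)$ and $P_n^{(\alpha,\beta,\gamma+1)}(x;a)\prec P_{n-1}^{(\alpha+1,\beta+1,\gamma+1)}(x;a)$.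
   Context: Angelesco-Jacobi polynomials: for $a<0$, $\alpha,\beta,\gamma>-1$ and $n\in\mathbb{N}\cup\{0\}$, $P_n^{(\alpha,\beta,\gamma)}(x;a)$ denotes the unique monic polynomial in $x$ of degree $2n$ such that for $k=0,1,\dots,n-1$, $$\int_a^0 x^k P_n^{(\alpha,\beta,\gamma)}(x;a)(1-x)^\alpha(x-a)^\beta|x|^\gamma\,dx=0,\qquad \int_0^1 x^k P_n^{(\alpha,\beta,\gamma)}(x;a)(1-x)^\alpha(x-a)^\beta x^\gamma\,dx=0.$$ All its zeros are real and simple; exactly $n$ of them lie in $(a,0)$ and exactly $n$ in $(0,1)$. Interlacing: let $(c,d)\subseteq\mathbb{R}$ be an open interval and $p,q$ polynomials, and let $\lambda_1(p)<\cdots<\lambda_k(p)$ and $\lambda_1(q)<\cdots<\lambda_j(q)$ be all the zeros of $p$ and of $q$, respectively, that belong to $(c,d)$, all of them simple. We write $p\prec q$ on $(c,d)$ if either $j=k$ and $\lambda_1(p)<\lambda_1(q)<\lambda_2(p)<\lambda_2(q)<\cdots<\lambda_k(p)<\lambda_k(q)$, or $j=k-1$ and $\lambda_1(p)<\lambda_1(q)<\lambda_2(p)<\lambda_2(q)<\cdots<\lambda_{k-1}(p)<\lambda_{k-1}(q)<\lambda_k(p)$. If no interval is mentioned, $(c,d)=\mathbb{R}$. *)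

(* Defs.v *)
From HB Require Import structures.
From mathcomp Require Import all_boot all_order all_algebra.
From mathcomp Require Import all_classical all_reals all_analysis.
Set Implicit Arguments.
Unset Strict Implicit.
Unset Printing Implicit Defensive.
Import Order.TTheory GRing.Theory Num.Theory.
Import numFieldNormedType.Exports.
Local Open Scope classical_set_scope.
Local Open Scope ring_scope.

(* On `]a, 0[ and `]0, 1[ with a < 0, the bases of the three powers are
   positive, so powR never takes a junk value there; on `]0, 1[ the factor
   `|x| `^ gamma is x `^ gamma. *)
Definition aj_weight (R : realType) (alpha beta gamma a x : R) : R :=
  (1 - x) `^ alpha * (x - a) `^ beta * `|x| `^ gamma.

Definition is_angelesco_jacobi (R : realType) (n : nat)
    (alpha beta gamma a : R) (P : {poly R}) : Prop :=
  [/\ P \is monic,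
      size P = (2 * n).+1,
      forall k : nat, (k < n)%N ->
        \int[lebesgue_measure]_(x in `]a, 0[)
          (x ^+ k * P.[x] * aj_weight alpha beta gamma a x) = 0 &
      forall k : nat, (k < n)%N ->
        \int[lebesgue_measure]_(x in `]0, 1[)
          (x ^+ k * P.[x] * aj_weight alpha beta gamma a x) = 0 ].

(* For a < 0 and alpha, beta, gamma > -1 exactly one polynomial satisfies
   is_angelesco_jacobi; outside this range the value may be the default 0. *)
Definition angelesco_jacobi (R : realType) (n : nat)
    (alpha beta gamma a : R) : {poly R} :=
  xget 0 [set P | is_angelesco_jacobi n alpha beta gamma a P].

Definition simple_zeros_in (R : realType) (I : interval R) (p : {poly R})
    (s : seq R) : Prop :=
  [/\ sorted <%R s,
      forall x : R, (x \in s) = (x \in I) && root p x &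
      forall x : R, x \in s -> mup x p = 1%N].

(* With k = size s and j = size t, the zero lambda_(i+1) is s`_i (resp. t`_i).
   The two inequality clauses cover both admissible cases j = k and
   j = k - 1: a comparison is required exactly when both indices exist. *)
Definition interlaces (R : realType) (I : interval R) (p q : {poly R}) : Prop :=
  exists s t : seq R,
    [/\ simple_zeros_in I p s,
        simple_zeros_in I q t,
        size t = size s \/ size s = (size t).+1,
        forall i : nat, (i < size t)%N -> s`_i < t`_i &
        forall i : nat, (i.+1 < size s)%N -> t`_i < s`_i.+1].

(* Main.v *)
Require Import Defs.
From HB Require Import structures.
From mathcomp Require Import all_boot all_order all_algebra.
From mathcomp Require Import all_classical all_reals all_analysis.
From mathcomp Require Import measurable_realfun.
From mathcomp Require Import ring lra zify.
From mathcomp.real_closed Require polyrcf.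
Import Order.TTheory GRing.Theory Num.Theory.
Import numFieldNormedType.Exports.
Local Open Scope classical_set_scope.
Local Open Scope ring_scope.

(* Put [Theta = x (x - a) (x - 1)], let [r] be the polynomial of degree [2 n - 2]
   with all three parameters raised by one, and [p] the one of degree [2 n].
   Integration by parts gives the Rodrigues formula
   [kappa p = (Theta r)' + (Theta w' / w) r], where
   [kappa = 2 n + 1 + alpha + beta + gamma].
   If [b] is one of [1, a, 0] and [q] is the polynomial of degree [2 n] whose
   weight is multiplied by [x - b] (up to sign), orthogonality yields
   [(1 + delta) (x - b) q = (x - b) p + delta Theta r], where [delta = n / kappa].
   At every zero [z] of [T = Theta r] these identities show that [p] and [q] have
   the sign of [T'(z)], hence [p] and [q] have exactly one zero in each gap between
   consecutive zeros of [T]. This interlaces them with [r]. In a given gap, the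
   sign of [q] at the zero [x] of [p] is that of [(x - b) T(x)], which places the
   zero of [q] to the right of [x] if [x > b] and to the left if [x < b]. *)

Set Implicit Arguments.
Unset Strict Implicit.
Unset Printing Implicit Defensive.

(** * Integration against Jacobi weights *)

Lemma powR_norm_gt0 (R : realType) (b e x : R) : x != b -> 0 < `|x - b| `^ e.
Proof. by move=> xb; rewrite powR_gt0// normr_gt0 subr_eq0. Qed.

Lemma powR_normS (R : realType) (b e x : R) : x != b ->
  `|x - b| `^ (e + 1) = `|x - b| * `|x - b| `^ e.
Proof.
move=> xb; rewrite powRD; last by rewrite normr_eq0 subr_eq0 xb implybT.
by rewrite powRr1// mulrC.
Qed.

(** Near [x] the absolute value is [s * (y - b)] with a constant sign [s], which reduces to a
    positive base. Dividing by [x - b] lets one formula serve both signs. *)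
Lemma is_derive_powR_norm (R : realType) (b e x : R) : x != b ->
  is_derive x 1 (fun y : R => `|y - b| `^ e) (e * `|x - b| `^ e / (x - b)).
Proof.
move=> xb; have xb0 : x - b != 0 by rewrite subr_eq0.
have key (s : R) : 0 < s * (x - b) -> s * s = 1 ->
    is_derive x 1 (fun y : R => `|y - b| `^ e) (e * `|x - b| `^ e / (x - b)).
  move=> s0 ss.
  have nE (y : R) : 0 < s * (y - b) -> `|y - b| = s * (y - b).
    move=> y0; rewrite -(gtr0_norm y0) normrM.
    have -> : `|s| = 1.
      by apply/eqP; rewrite -(@pexpr_eq1 _ `|s| 2)// expr2 -normrM ss normr1.
    by rewrite mul1r.
  apply: (@near_eq_is_derive _ _ _ (fun y : R => (s * (y - b)) `^ e)).
    have cf : s * (y - b) @[y --> x] --> s * (x - b).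
      by apply: cvgM; [exact: cvg_cst|apply: cvgB; [exact: cvg_id|exact: cvg_cst]].
    near=> y; rewrite nE//; near: y.
    exact: (cvgr_gt _ cf).
  have := @is_derive1_comp R (@powR R ^~ e) (fun y : R => s * (y - b)) x _ s
    (is_derive1_powR e s0).
  have ds : is_derive x (1 : R) (fun y : R => s * (y - b)) s.
    rewrite (_ : (fun y : R => _) = horner (s *: ('X - b%:P))); last first.
      by apply/funext => y; rewrite hornerZ hornerXsubC.
    have := is_derive_poly (s *: ('X - b%:P)) x.
    by rewrite derivZ derivXsubC hornerZ hornerC mulr1.
  move=> /(_ ds); rewrite /comp.
  have s_neq0 : s != 0 by apply: contraTneq s0 => ->; rewrite mul0r ltxx.
  suff -> : e * (s * (x - b)) `^ (e - 1) * s = e * `|x - b| `^ e / (x - b) by [].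
  rewrite (nE _ s0) powRB; last by rewrite (gt_eqF s0) implybT.
  rewrite powRr1 ?(ltW s0)//.
  by field; rewrite xb0.
have [x0|x0|/eqP] := ltgtP (x - b) 0; last by rewrite (negbTE xb0).
- by apply: (key (-1)); rewrite ?mulN1r ?oppr_gt0 ?opprK.
- by apply: (key 1); rewrite mul1r.
Unshelve. all: end_near. Qed.

Lemma continuous_powR_norm_neq (R : realType) (b e x : R) : x != b ->
  {for x, continuous (fun y : R => `|y - b| `^ e)}.
Proof.
move=> xb; apply/differentiable_continuous/derivable1_diffP.
by case: (is_derive_powR_norm e xb).
Qed.

Lemma continuous_powR_norm (R : realType) (b e : R) : 0 < e ->
  continuous (fun x : R => `|x - b| `^ e).
Proof.
move=> e0 x; have [->|xb] := eqVneq x b; last first.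
  exact: continuous_powR_norm_neq.
apply/cvgrPdist_lt => /= eps eps0.
rewrite subrr normr0 powR0 ?gt_eqF//.
have d0 : 0 < eps `^ e^-1 by rewrite powR_gt0.
near=> y; rewrite sub0r normrN ger0_norm ?powR_ge0//.
rewrite -[ltRHS](powRr1 (ltW eps0)) -(mulVf (lt0r_neq0 e0)) powRrM.
apply: gt0_ltr_powR; rewrite ?nnegrE ?powR_ge0//.
Unshelve. all: end_near. Qed.

(** On the compact subintervals [A i] the fundamental theorem bounds the integral by the oscillation
    of [F]; monotone convergence passes to the open interval. *)
Lemma ge0_primitive_integrable (R : realType) (c d : R) (f F : R -> R) :
  c < d -> {in `]c, d[, continuous f} -> {in `]c, d[, forall x, 0 <= f x} ->
  {within `[c, d], continuous F} ->
  {in `]c, d[, forall x, is_derive x (1 : R) F (f x)} ->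
  lebesgue_measure.-integrable `]c, d[ (EFin \o f).
Proof.
move=> cd fc f0 Fc F'.
have mf : measurable_fun `]c, d[ f.
  by apply: open_continuous_measurable_fun => // x; rewrite inE => /fc.
have [M _ FM] := EVT_max (ltW cd) Fc.
have [m _ Fm] := EVT_min (ltW cd) Fc.
apply/integrableP; split; first exact/measurable_EFinP.
under eq_integral => x.
  rewrite inE => /f0 fx0; rewrite /= ger0_norm//; over.
(* Dividing by at least 3 keeps [c + e i < d - e i] even for [i = 0]. *)
pose e (i : nat) : R := (d - c) / (i.+3)%:R.
have e0 i : 0 < e i by rewrite divr_gt0 ?subr_gt0.
have e2 i : c + e i < d - e i.
  have : e i * 3 <= d - c.
    by rewrite /e mulrAC ler_pdivrMr// ler_wpM2l ?subr_ge0 ?(ltW cd)// ler_nat.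
  have := e0 i; lra.
have en i j : (i <= j)%N -> e j <= e i.
  move=> ij; rewrite /e ler_wpM2l ?subr_ge0 ?(ltW cd)//.
  by rewrite lef_pV2 ?posrE ?ltr0n// ler_nat.
pose A (i : nat) := `[c + e i, d - e i]%classic.
have AE : `]c, d[%classic = \bigcup_i A i.
  apply/seteqP; split=> x; last first.
    move=> [i _]; rewrite /A/= !in_itv/= => /andP[cx xd].
    by have ei0 := e0 i; apply/andP; split; lra.
  rewrite /= in_itv/= => /andP[cx xd].
  pose k := Num.Def.truncn ((d - c) / Num.min (x - c) (d - x)).
  have m0 : 0 < Num.min (x - c) (d - x) by rewrite lt_min !subr_gt0 cx.
  have : e k <= Num.min (x - c) (d - x).
    rewrite /e ler_pdivrMr ?ltr0n// mulrC -ler_pdivrMr//.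
    have hk : (d - c) / Num.min (x - c) (d - x) < k.+1%:R.
      exact: (real_truncnS_gt (num_real _)).
    by rewrite (le_trans (ltW hk))// ler_nat -addn2 leq_addr.
  rewrite le_min => /andP[ex xe]; exists k => //.
  by rewrite /A/= in_itv/=; apply/andP; split; lra.
have AS i : A i `<=` `]c, d[ by rewrite AE; exact: bigcup_sup.
have nnA : {homo A : i j / (i <= j)%N >-> (i <= j)%O}.
  move=> i j ij; apply/subsetPset => x; rewrite /A/= !in_itv/= => /andP[h1 h2].
  by have eij := en _ _ ij; apply/andP; split; lra.
have mA i : measurable (A i) by exact: measurable_itv.
have fA0 i x : A i x -> (0 <= (EFin \o f) x)%E.
  by move=> /AS/f0 fx0; rewrite /= lee_fin.
have := @ge0_nondecreasing_set_cvg_integral _ (measurableTypeR R) R A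
  (EFin \o f) lebesgue_measure
  nnA mA _ fA0.
rewrite -AE => /(_ _) cvgA.
have {}cvgA := cvgA (fun i =>
  measurable_funS (measurable_itv _) (AS i) ((measurable_EFinP _ _).2 mf)).
apply: (@le_lt_trans _ _ (F M - F m)%:E); last by rewrite ltry.
have /cvg_lim <- // := cvgA.
apply: lime_le; first by apply/cvg_ex; eexists; exact: cvgA.
apply: nearW => i.
rewrite /= (@continuous_FTC2 _ f F) ?e2//; last 3 first.
- apply: continuous_in_subspaceT => x; rewrite inE => /AS xcd.
  exact: fc.
- split.
  + move=> x xe; have /F' [] // : x \in `]c, d[.
    by apply: AS; apply: subset_itv_oo_cc xe.
  + have : {within A i, continuous F}.
      apply: continuous_subspaceW Fc => x /AS; exact: subset_itv_oo_cc.
    by move=> /(continuous_within_itvP _ (e2 i))[].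
  + have : {within A i, continuous F}.
      apply: continuous_subspaceW Fc => x /AS; exact: subset_itv_oo_cc.
    by move=> /(continuous_within_itvP _ (e2 i))[].
- move=> x xe; have /F' [_ <-] : x \in `]c, d[.
    by apply: AS; apply: subset_itv_oo_cc xe.
  by rewrite derive1E.
rewrite -EFinB lee_fin lerB//.
- apply: FM; rewrite in_itv/=; have e0i := e0 i; have e2i := e2 i.
  by apply/andP; split; lra.
- apply: Fm; rewrite in_itv/=; have e0i := e0 i; have e2i := e2 i.
  by apply/andP; split; lra.
Qed.

(** Up to the sign [s] of [x - b], a primitive is [|x - b| ^ (e + 1) / (e + 1)], continuous up to
    the singular endpoint because [e + 1 > 0]. *)
Lemma powR_norm_integrable (R : realType) (c d b e : R) :
  c < d -> -1 < e -> b = c \/ b = d ->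
  lebesgue_measure.-integrable `]c, d[ (EFin \o (fun x => `|x - b| `^ e)).
Proof.
move=> cd e1 bcd.
have e10 : 0 < e + 1 by lra.
have xb x : x \in `]c, d[ -> x != b.
  rewrite in_itv/= => /andP[cx xd].
  by case: bcd => ->; rewrite ?(gt_eqF cx) ?(lt_eqF xd).
pose s : R := if b == c then 1 else -1.
have sE x : x \in `]c, d[ -> `|x - b| = s * (x - b).
  rewrite in_itv/= /s => /andP[cx xd].
  case: bcd => ->; first by rewrite eqxx mul1r gtr0_norm// subr_gt0.
  by rewrite (gt_eqF cd) mulN1r ltr0_norm// subr_lt0.
apply: (@ge0_primitive_integrable _ _ _ _
  (fun x => s / (e + 1) * `|x - b| `^ (e + 1))) => //.
- by move=> x xcd; exact: continuous_powR_norm_neq (xb _ xcd).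
- apply: continuous_subspaceT => x.
  by apply: cvgM; [exact: cvg_cst|exact: continuous_powR_norm].
- move=> x xcd; have xb' := xb _ xcd.
  have := is_derive_powR_norm (e + 1) xb'.
  move=> /(is_deriveZ (s / (e + 1))).
  suff -> : (s / (e + 1)) *: ((e + 1) * `|x - b| `^ (e + 1) / (x - b)) = `|x - b| `^ e.
    by [].
  rewrite powR_normS// {1}(sE _ xcd) /GRing.scale/=.
  have ss : s * s = 1 by rewrite /s; case: ifP => _; rewrite ?mulrNN mulr1.
  have xb0 : x - b != 0 by rewrite subr_eq0.
  transitivity (s * s * `|x - b| `^ e); last by rewrite ss mul1r.
  by field; rewrite xb0 lt0r_neq0.
Qed.

(** Here [f] may blow up at the endpoints. Its indefinite integral [G] is still continuous on the
    closed interval, and the mean value theorem shows that [F - G] takes the same value at both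
    ends. *)
Lemma integrable_FTC (R : realType) (c d : R) (f F : R -> R) :
  c < d -> {in `]c, d[, continuous f} ->
  lebesgue_measure.-integrable `]c, d[ (EFin \o f) ->
  {within `[c, d], continuous F} ->
  {in `]c, d[, forall x, is_derive x (1 : R) F (f x)} ->
  \int[lebesgue_measure]_(x in `]c, d[) f x = F d - F c.
Proof.
move=> cd fc fi Fc F'.
pose g := f \_ `]c, d[.
have gi : lebesgue_measure.-integrable `[c, d] (EFin \o g).
  by rewrite -restrict_EFin; apply/integrable_restrict => //; rewrite setIidr//;
    exact: subset_itv_oo_cc.
pose G x := \int[lebesgue_measure]_(t in `[c, x]) g t.
have G' x : x \in `]c, d[ -> is_derive x (1 : R) G (f x).
  move=> xcd.
  have gx : {for x, continuous g}.
    have gf : \forall y \near x, f y = g y.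
      near=> y; rewrite /g patchE mem_set//=; near: y; exact: near_in_itvoo.
    rewrite /prop_for /continuous_at -(nbhs_singleton gf).
    apply: cvg_trans (fc _ xcd).
    exact: near_eq_cvg.
  move: (xcd); rewrite in_itv/= => /andP[cx xd].
  have [dG eG] := continuous_FTC1_closed xd gi cx gx.
  have gE : g x = f x by rewrite /g patchE mem_set.
  by rewrite -gE -eG derive1E; exact: DeriveDef.
have Gc : {within `[c, d], continuous G}.
  exact: parameterized_integral_continuous (ltW cd) gi.
have [x xcd|x|z _] := @MVT _ (F \- G) (cst 0) c d cd.
- have /= := is_deriveB (F' _ xcd) (G' _ xcd).
  by rewrite subrr.
- by apply: cvgB; [exact: Fc|exact: Gc].
rewrite mul0r /= => FG.
have -> : \int[lebesgue_measure]_(x in `]c, d[) f x = G d.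
  rewrite /G Rintegral_mkcond [RHS]Rintegral_mkcond; congr Rintegral.
  rewrite /g -patch_setI setIidr//; exact: subset_itv_oo_cc.
have Gc0 : G c = 0 by rewrite /G set_itv1 Rintegral_set1.
by move: FG; rewrite Gc0; lra.
Unshelve. all: by end_near. Qed.

Section jacobi_weight.
Variables (R : realType) (c d o : R).
Hypothesis cd : c < d.
Hypothesis ocd : o \notin `[c, d].

(** The endpoints [c] and [d] carry the possible singularities, while the third node [o] lies
    outside the closed interval. This form covers both intervals of orthogonality. *)
Definition jacobi_weight (e1 e2 e3 x : R) : R :=
  `|x - c| `^ e1 * `|x - d| `^ e2 * `|x - o| `^ e3.

Lemma jacobi_nodes x : x \in `]c, d[ -> [/\ x != c, x != d & x != o].
Proof.
move=> xcd; split; last 1 first.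
- by apply: contraNneq ocd => <-; exact: subset_itv_oo_cc.
- by rewrite gt_eqF// (itvP xcd).
- by rewrite lt_eqF// (itvP xcd).
Qed.

Lemma jacobi_weight_gt0 e1 e2 e3 x :
  x \in `]c, d[ -> 0 < jacobi_weight e1 e2 e3 x.
Proof. by move=> /jacobi_nodes[*]; rewrite !mulr_gt0// powR_norm_gt0. Qed.

Lemma bounded_powR_norm (b e u v : R) : u <= v -> b \notin `[u, v] ->
  exists2 K, 0 <= K & {in `[u, v], forall x, `|x - b| `^ e <= K}.
Proof.
move=> uv buv.
have [|m muv mmax] := @EVT_max _ (fun x => `|x - b| `^ e) u v uv.
  apply: continuous_in_subspaceT => x; rewrite inE/= => xuv.
  by apply: continuous_powR_norm_neq; apply: contraNneq buv => <-.
by exists (`|m - b| `^ e); [exact: powR_ge0|].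
Qed.

Lemma jacobi_weight_continuous (h : {poly R}) e1 e2 e3 :
  {in `]c, d[, continuous (fun x => h.[x] * jacobi_weight e1 e2 e3 x)}.
Proof.
move=> x /jacobi_nodes[xc xd xo].
apply: cvgM; first exact: continuous_horner.
by apply: cvgM; [apply: cvgM|]; exact: continuous_powR_norm_neq.
Qed.

(** Left of the midpoint only the factor at [c] can be unbounded, right of it only the one at [d]; a
    combination of these two integrable powers dominates. *)
Lemma jacobi_weight_integrable (h : {poly R}) e1 e2 e3 :
  -1 < e1 -> -1 < e2 ->
  lebesgue_measure.-integrable `]c, d[
    (EFin \o (fun x => h.[x] * jacobi_weight e1 e2 e3 x)).
Proof.
move=> e1N e2N.
have mid := midf_lt cd.
set m := (c + d) / 2 in mid; case: mid => cm md.
have [K1 K10 K1P] : exists2 K, 0 <= K & {in `[m, d], forall x, `|x - c| `^ e1 <= K}.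
  by apply: bounded_powR_norm (ltW md) _; rewrite in_itv/= negb_and -ltNge cm.
have [K2 K20 K2P] : exists2 K, 0 <= K & {in `[c, m], forall x, `|x - d| `^ e2 <= K}.
  by apply: bounded_powR_norm (ltW cm) _; rewrite in_itv/= negb_and -!ltNge md orbT.
have [K3 K30 K3P] := bounded_powR_norm e3 (ltW cd) ocd.
have [K4 K4P] : exists K, {in `[c, d], forall x, `|h.[x]| <= K}.
  have [|M Mcd Mmax] := @EVT_max _ (fun x => `|h.[x]|) c d (ltW cd).
    apply: continuous_subspaceT => x.
    by apply: cvg_norm; exact: continuous_horner.
  by exists `|h.[M]|.
pose B x := K4 * K3 * (K2 * `|x - c| `^ e1 + K1 * `|x - d| `^ e2).
have iB : lebesgue_measure.-integrable `]c, d[ (EFin \o B).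
  have i1 := powR_norm_integrable cd e1N (or_introl (erefl c)).
  have i2 := powR_norm_integrable cd e2N (or_intror (erefl d)).
  have mI : @measurable _ (measurableTypeR R) `]c, d[%classic by exact: measurable_itv.
  have := integrableZl mI (K4 * K3)
    (integrableD mI (integrableZl mI K2 i1) (integrableZl mI K1 i2)).
  by congr (_.-integrable _ _); apply/funext => x /=.
apply: le_integrable iB => //.
- have mf : measurable_fun `]c, d[ (fun x => h.[x] * jacobi_weight e1 e2 e3 x).
    apply: open_continuous_measurable_fun => // x; rewrite inE.
    exact: jacobi_weight_continuous.
  exact/measurable_EFinP.
- move=> x /= xcd; rewrite lee_fin normrM.
  have xcd' : x \in `[c, d] by exact: subset_itv_oo_cc.
  rewrite (gtr0_norm (jacobi_weight_gt0 _ _ _ xcd)).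
  apply: le_trans (ler_norm _).
  rewrite /B -mulrA; apply: ler_pM => //; first exact/ltW/jacobi_weight_gt0.
    exact: K4P.
  rewrite /jacobi_weight mulrC; apply: ler_pM; rewrite ?mulr_ge0 ?powR_ge0//.
    exact: K3P.
  have [xm|mx] := leP x m.
    apply: (@le_trans _ _ (K2 * `|x - c| `^ e1)); last first.
      by rewrite lerDl mulr_ge0// powR_ge0.
    rewrite mulrC ler_wpM2r ?powR_ge0// K2P//.
    by rewrite in_itv/= (itvP xcd').
  apply: (@le_trans _ _ (K1 * `|x - d| `^ e2)); last first.
    by rewrite lerDr mulr_ge0// powR_ge0.
  rewrite ler_wpM2r ?powR_ge0// K1P//.
  by rewrite in_itv/= (itvP xcd') (ltW mx).
Qed.

End jacobi_weight.

(** * Weighted integrals over the two intervals of orthogonality *)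

(** This is [Theta] in the overview; its roots are the endpoints of the two intervals. *)
Definition aj_nodes (R : realType) (a : R) : {poly R} :=
  'X * ('X - a%:P) * ('X - 1%:P).

(* The polynomial [aj_nodes * w' / w], where [w] is the weight. *)
Definition aj_slope (R : realType) (al be ga a : R) : {poly R} :=
  al *: ('X * ('X - a%:P)) + be *: ('X * ('X - 1%:P)) +
  ga *: (('X - a%:P) * ('X - 1%:P)).

Definition aj_int (R : realType) (al be ga a c d : R) (h : {poly R}) : R :=
  \int[lebesgue_measure]_(x in `]c, d[) (h.[x] * aj_weight al be ga a x).

(** Through this predicate each fact about integrals is proved once for both intervals. *)
Definition aj_itv (R : realType) (a c d : R) : Prop :=
  (c = a /\ d = 0) \/ (c = 0 /\ d = 1).

Lemma is_deriveM_fun (R : realType) (f g : R -> R) (x df dg : R) :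
  is_derive x (1 : R) f df -> is_derive x (1 : R) g dg ->
  is_derive x (1 : R) (fun y => f y * g y) (df * g x + f x * dg).
Proof.
move=> f' g'; have := is_deriveM f' g'.
by rewrite addrC (_ : g x *: df = df * g x)// [LHS]mulrC.
Qed.

Lemma poly_roots_finite (R : realType) (p : {poly R}) :
  p != 0 -> finite_set [set x | root p x].
Proof.
move=> p0; apply: contrapT => /(infinite_set_fset (size p)) [B BA].
apply/negP; rewrite -ltnNge; apply: max_poly_roots => //.
  by apply/allP => x xB; exact: BA.
exact: finmap.fset_uniq.
Qed.

Section aj_integral.
Variables (R : realType) (a c d : R).
Hypotheses (a0 : a < 0) (acd : aj_itv a c d).

Lemma aj_itv_lt : c < d.
Proof. by case: acd => -[-> ->]. Qed.

Lemma aj_itv_neq (x : R) : x \in `]c, d[ -> [/\ x != 1, x != a & x != 0].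
Proof.
rewrite in_itv/= => /andP[cx xd].
case: acd => -[E1 E2]; rewrite E1 E2 in cx xd.
  by rewrite (lt_eqF (lt_trans xd ltr01)) (gt_eqF cx) (lt_eqF xd).
by rewrite (lt_eqF xd) (gt_eqF (lt_trans a0 cx)) (gt_eqF cx).
Qed.

(* With every base written as [`|x - b|], the weight with all exponents raised
   by one is continuous on the whole line, endpoints included. *)
Lemma aj_weightE al be ga (x : R) : x \in `]c, d[ ->
  aj_weight al be ga a x = `|x - 1| `^ al * `|x - a| `^ be * `|x - 0| `^ ga.
Proof.
rewrite in_itv/= subr0 /aj_weight => /andP[cx xd].
have [x1 xa] : x < 1 /\ a < x.
  case: acd => -[E1 E2]; rewrite E1 E2 in cx xd.
    by split; [exact: lt_trans xd ltr01|].
  by split; [|exact: lt_trans a0 cx].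
have -> : `|x - 1| = 1 - x by rewrite ltr0_norm ?subr_lt0// opprB.
by have -> : `|x - a| = x - a by rewrite gtr0_norm ?subr_gt0.
Qed.

Lemma aj_weight_gt0 al be ga (x : R) : x \in `]c, d[ -> 0 < aj_weight al be ga a x.
Proof.
move=> xcd; have [x1 xa x0] := aj_itv_neq xcd.
by rewrite aj_weightE// !mulr_gt0// powR_norm_gt0.
Qed.

Lemma aj_weight_continuous (h : {poly R}) al be ga :
  {in `]c, d[, continuous (fun x => h.[x] * aj_weight al be ga a x)}.
Proof.
move=> x xcd; have [x1 xa x0] := aj_itv_neq xcd.
pose g y := h.[y] * (`|y - 1| `^ al * `|y - a| `^ be * `|y - 0| `^ ga).
have gx : g y @[y --> x] --> h.[x] * aj_weight al be ga a x.
  rewrite aj_weightE//; apply: cvgM; first exact: continuous_horner.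
  by apply: cvgM; [apply: cvgM|]; exact: continuous_powR_norm_neq.
apply: cvg_trans gx; apply: near_eq_cvg.
near=> y; rewrite /g aj_weightE//; near: y; exact: near_in_itvoo.
Unshelve. all: by end_near. Qed.

Lemma aj_integrable al be ga (h : {poly R}) : -1 < al -> -1 < be -> -1 < ga ->
  lebesgue_measure.-integrable `]c, d[
    (EFin \o (fun x => h.[x] * aj_weight al be ga a x)).
Proof.
move=> al1 be1 ga1.
suff : exists o e1 e2 e3, o \notin `[c, d] /\
    [/\ -1 < e1, -1 < e2 & {in `]c, d[, forall x : R,
      aj_weight al be ga a x = jacobi_weight c d o e1 e2 e3 x}].
  move=> [p [e1 [e2 [e3 [ocd [e1N e2N wE]]]]]].
  have := jacobi_weight_integrable aj_itv_lt ocd h e3 e1N e2N.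
  apply: eq_integrable => // x; rewrite inE/= => xcd.
  by rewrite wE.
(* The node that is not an endpoint takes the role of [o]: [1] for the left interval, [a] for the
   right one. *)
case: acd => -[E1 E2].
- exists 1, be, ga, al; split; first by rewrite E1 E2 in_itv/= ler10 andbF.
  split=> // x xcd; rewrite aj_weightE// /jacobi_weight E1 E2; ring.
- exists a, ga, al, be; split; first by rewrite E1 E2 in_itv/= leNgt a0.
  split=> // x xcd; rewrite aj_weightE// /jacobi_weight E1 E2; ring.
Qed.

Lemma aj_intD al be ga (g h : {poly R}) : -1 < al -> -1 < be -> -1 < ga ->
  aj_int al be ga a c d (g + h) =
  aj_int al be ga a c d g + aj_int al be ga a c d h.
Proof.
move=> al1 be1 ga1; rewrite /aj_int.
under eq_Rintegral do rewrite hornerD mulrDl.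
by rewrite RintegralD//; exact: aj_integrable.
Qed.

Lemma aj_intZ al be ga k (h : {poly R}) : -1 < al -> -1 < be -> -1 < ga ->
  aj_int al be ga a c d (k *: h) = k * aj_int al be ga a c d h.
Proof.
move=> al1 be1 ga1; rewrite /aj_int.
under eq_Rintegral do rewrite hornerZ -mulrA.
by rewrite RintegralZl//; exact: aj_integrable.
Qed.

(** A zero integral would make the integrand vanish almost everywhere. As the weight is positive, a
    null set and the finitely many roots of [h] would then cover an interval of positive length. *)
Lemma aj_int_gt0 al be ga (h : {poly R}) : -1 < al -> -1 < be -> -1 < ga ->
  h != 0 -> {in `]c, d[, forall x, 0 <= h.[x]} -> 0 < aj_int al be ga a c d h.
Proof.
move=> al1 be1 ga1 h0 hge0.
have hw_ge0 x : x \in `]c, d[ -> 0 <= h.[x] * aj_weight al be ga a x.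
  by move=> xcd; rewrite mulr_ge0 ?hge0// ltW// aj_weight_gt0.
have hi := aj_integrable h al1 be1 ga1.
rewrite lt_neqAle Rintegral_ge0 ?andbT//; apply: contraNneq h0 => int0.
have mI : @measurable _ (measurableTypeR R) `]c, d[%classic by exact: measurable_itv.
pose f : R -> \bar R := fun x => (h.[x] * aj_weight al be ga a x)%:E.
have abs0 : (\int[lebesgue_measure]_(x in `]c, d[) `|f x| = 0)%E.
  transitivity (\int[lebesgue_measure]_(x in `]c, d[) f x)%E.
    by apply: eq_integral => x; rewrite inE/= => xcd; rewrite ger0_norm ?hw_ge0.
  rewrite -[LHS]fineK; last exact: integrable_fin_num.
  by congr EFin; rewrite int0.
have [mh _] := integrableP _ _ _ hi.
have [N [mN N0 subN]] := (ae_eq_integral_abs lebesgue_measure mI mh).1 abs0.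
apply/negP => /negP hn0.
have Z0 : lebesgue_measure [set x | root h x] = 0%E.
  exact/countable_lebesgue_measure0/finite_set_countable/poly_roots_finite.
have mZ : @measurable _ (measurableTypeR R) [set x | root h x].
  apply: countable_measurable; first by move=> t; exact: measurable_set1.
  exact/finite_set_countable/poly_roots_finite.
have sub : `]c, d[%classic `<=` N `|` [set x | root h x].
  move=> x xcd; have [hx|hx] := boolP (root h x); first by right.
  left; apply: subN => /(_ xcd) [] /eqP.
  by rewrite mulf_eq0 (gt_eqF (aj_weight_gt0 _ _ _ xcd)) orbF; exact/negP.
have I0 : lebesgue_measure `]c, d[%classic = 0%E.
  apply: (subset_measure0 mI (measurableU _ _ mN mZ) sub).
  exact: etrans (measureU0 mN mZ Z0) N0.
move: I0; rewrite lebesgue_measure_itv/= lte_fin aj_itv_lt => /eqP.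
by rewrite -EFinB eqe subr_eq0 gt_eqF// aj_itv_lt.
Qed.

(** Outside the open interval a node leaves [x - b] of constant sign, so [s] is [1] or [-1]. This
    turns the absolute values in the weight into polynomial factors. *)
Lemma aj_node_sign b : b \notin `]c, d[ -> exists2 s : R, s != 0 &
  {in `]c, d[, forall x : R, `|x - b| = s * (x - b)}.
Proof.
move=> bcd; have [bc|cb] := leP b c.
  exists 1 => [|x]; rewrite ?oner_eq0// in_itv/= => /andP[cx xd].
  by rewrite mul1r ger0_norm// subr_ge0 (le_trans bc) ?ltW.
exists (-1) => [|x]; rewrite ?oppr_eq0 ?oner_eq0// in_itv/= => /andP[cx xd].
have db : d <= b by move: bcd; rewrite in_itv/= cb/= -leNgt.
by rewrite mulN1r ler0_norm// subr_le0 (le_trans _ db) ?ltW.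
Qed.

Lemma aj_itv_notin b : b \in [:: 1; a; 0] -> b \notin `]c, d[.
Proof.
rewrite !inE => bE; apply/negP => /aj_itv_neq[b1 ba b0].
by move: bE; rewrite (negbTE b1) (negbTE ba) (negbTE b0).
Qed.

(** A change of parameters that multiplies the weight by a polynomial moves this polynomial into the
    integrand, which makes orthogonality for the two weights comparable. *)
Lemma aj_int_shift al be ga al' be' ga' (p : {poly R}) s :
  {in `]c, d[, forall x : R,
    aj_weight al' be' ga' a x = s * p.[x] * aj_weight al be ga a x} ->
  -1 < al -> -1 < be -> -1 < ga ->
  forall h, aj_int al' be' ga' a c d h = s * aj_int al be ga a c d (p * h).
Proof.
move=> wE al1 be1 ga1 h; rewrite -aj_intZ// /aj_int.
apply: eq_Rintegral => x; rewrite inE/= => /wE ->.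
by rewrite hornerZ hornerM; ring.
Qed.

Lemma aj_int_shift1 al be ga : -1 < al -> -1 < be -> -1 < ga ->
  exists2 s : R, s != 0 & forall h, aj_int (al + 1) be ga a c d h =
    s * aj_int al be ga a c d (('X - 1%:P) * h).
Proof.
move=> al1 be1 ga1.
have [|s s0 sE] := @aj_node_sign 1; first by rewrite aj_itv_notin ?inE ?eqxx.
exists s => //; apply: aj_int_shift => // x xcd.
have [x1 _ _] := aj_itv_neq xcd.
by rewrite !aj_weightE// powR_normS// sE// hornerXsubC !mulrA.
Qed.

Lemma aj_int_shifta al be ga : -1 < al -> -1 < be -> -1 < ga ->
  exists2 s : R, s != 0 & forall h, aj_int al (be + 1) ga a c d h =
    s * aj_int al be ga a c d (('X - a%:P) * h).
Proof.
move=> al1 be1 ga1.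
have [|s s0 sE] := @aj_node_sign a; first by rewrite aj_itv_notin ?inE ?eqxx ?orbT.
exists s => //; apply: aj_int_shift => // x xcd.
have [_ xa _] := aj_itv_neq xcd.
by rewrite !aj_weightE// powR_normS// sE// hornerXsubC; ring.
Qed.

Lemma aj_int_shift0 al be ga : -1 < al -> -1 < be -> -1 < ga ->
  exists2 s : R, s != 0 & forall h, aj_int al be (ga + 1) a c d h =
    s * aj_int al be ga a c d (('X - 0%:P) * h).
Proof.
move=> al1 be1 ga1.
have [|s s0 sE] := @aj_node_sign 0; first by rewrite aj_itv_notin ?inE ?eqxx ?orbT.
exists s => //; apply: aj_int_shift => // x xcd.
have [_ _ x0] := aj_itv_neq xcd.
by rewrite !aj_weightE// powR_normS// sE// hornerXsubC; ring.
Qed.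

Lemma aj_int_shift_nodes al be ga : -1 < al -> -1 < be -> -1 < ga ->
  exists2 s : R, s != 0 & forall h, aj_int (al + 1) (be + 1) (ga + 1) a c d h =
    s * aj_int al be ga a c d (aj_nodes a * h).
Proof.
move=> al1 be1 ga1.
have [s1 s10 s1E] := aj_int_shift1 al1 (ltr_wpDr ler01 be1) (ltr_wpDr ler01 ga1).
have [s2 s20 s2E] := aj_int_shifta al1 be1 (ltr_wpDr ler01 ga1).
have [s3 s30 s3E] := aj_int_shift0 al1 be1 ga1.
exists (s1 * s2 * s3) => [|h]; first by rewrite !mulf_neq0.
rewrite s1E s2E s3E /aj_nodes subr0 !mulrA; congr (_ * aj_int _ _ _ _ _ _ _); ring.
Qed.

(* The integrand times the weight is, up to sign, the derivative of [h] times the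
   weight with raised exponents, which vanishes at both endpoints. *)
Lemma aj_int_by_parts al be ga (h : {poly R}) : -1 < al -> -1 < be -> -1 < ga ->
  aj_int al be ga a c d ((aj_nodes a * h)^`() + aj_slope al be ga a * h) = 0.
Proof.
move=> al1 be1 ga1.
have [|s1 s10 s1E] := @aj_node_sign 1; first by rewrite aj_itv_notin ?inE ?eqxx.
have [|s2 s20 s2E] := @aj_node_sign a; first by rewrite aj_itv_notin ?inE ?eqxx ?orbT.
have [|s3 s30 s3E] := @aj_node_sign 0; first by rewrite aj_itv_notin ?inE ?eqxx ?orbT.
have s0 : s1 * s2 * s3 != 0 by rewrite !mulf_neq0.
(* The factor [s1 * s2 * s3] turns [aj_nodes] into the product of the absolute values, so that the
   integrand is exactly the derivative of [F]. *)
apply: (mulfI s0); rewrite mulr0 -aj_intZ//.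
pose F x := h.[x] *
  (`|x - 1| `^ (al + 1) * `|x - a| `^ (be + 1) * `|x - 0| `^ (ga + 1)).
have [al2 be2 ga2] : [/\ 0 < al + 1, 0 < be + 1 & 0 < ga + 1] by split; lra.
rewrite /aj_int (@integrable_FTC _ c d _ F aj_itv_lt).
- have F0 b : b \in [:: 1; a; 0] -> F b = 0.
    rewrite /F !inE => /or3P[]/eqP ->; rewrite subrr normr0 powR0 ?gt_eqF//; ring.
  by case: acd => -[-> ->]; rewrite !F0 ?inE ?eqxx ?orbT// subrr.
- exact: aj_weight_continuous.
- exact: aj_integrable.
- apply: continuous_subspaceT => x.
  apply: cvgM; first exact: continuous_horner.
  by apply: cvgM; [apply: cvgM|]; exact: continuous_powR_norm.
- move=> x xcd; have [x1 xa x0] := aj_itv_neq xcd.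
  have F' := is_deriveM_fun (is_derive_poly h x) (is_deriveM_fun (is_deriveM_fun
    (is_derive_powR_norm (al + 1) x1) (is_derive_powR_norm (be + 1) xa))
    (is_derive_powR_norm (ga + 1) x0)).
  apply: (trigger_derive F').
  rewrite aj_weightE// !powR_normS// s1E// s2E// s3E//.
  rewrite /aj_nodes /aj_slope !(derivM, derivD, derivX, derivN, derivC, derivXsubC).
  rewrite !(hornerZ, hornerM, hornerD, hornerN, hornerC, hornerX) subr0.
  by field; rewrite x0 !subr_eq0 x1 xa.
Qed.

End aj_integral.

(** * Orthogonality and the Rodrigues formula *)

Lemma monic_sizeP (R : nzRingType) (p : {poly R}) m :
  p`_m = 1 -> (forall j, (m < j)%N -> p`_j = 0) -> p \is monic /\ size p = m.+1.
Proof.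
move=> pm pj; have sp : size p = m.+1.
  apply/eqP; rewrite eqn_leq; apply/andP; split; first exact/leq_sizeP.
  rewrite ltnNge; apply: contra_neqN (oner_neq0 R) => sm.
  by rewrite -pm nth_default.
by split=> //; rewrite monicE lead_coefE sp pm.
Qed.

Lemma coef_monic_lead (R : nzRingType) (r : {poly R}) m :
  r \is monic -> size r = m.+1 -> r`_m = 1.
Proof. by rewrite monicE lead_coefE => /eqP + sr; rewrite sr. Qed.

(** The list [s] collects the roots of odd multiplicity in the interval, where [p] changes sign; the
    constant [e] fixes the sign of the product. The induction divides out one root at a time. *)
Lemma poly_sign_factor (R : realType) (c d : R) (p : {poly R}) : p != 0 ->
  exists s : seq R, [/\ uniq s, all (root p) s, {subset s <= `]c, d[} &
    exists2 e : R, e != 0 & {in `]c, d[, forall x,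
      0 <= (e *: (\prod_(z <- s) ('X - z%:P) * p)).[x]}].
Proof.
have [m] := ubnP (size p); elim: m p => // m IH p spm p0.
have [[z zcd rz]|noroot] := pselect (exists2 z, z \in `]c, d[ & root p z); last first.
  exists [::]; split=> //.
  have [|x0] := leP d c.
    move=> dc; exists 1; rewrite ?oner_eq0// => x; rewrite in_itv/= => /andP[cx xd].
    by have := lt_trans cx (lt_le_trans xd dc); rewrite ltxx.
  pose y := (c + d) / 2.
  have ycd : y \in `]c, d[ by rewrite in_itv/= !midf_lt.
  have nr x : x \in `]c, d[ -> p.[x] != 0.
    by move=> xcd; apply: contra_notN noroot => px; exists x.
  (* Without roots in the interval the sign is that at the midpoint, by the intermediate value
     theorem. *)
  exists p.[y]; first exact: nr.
  move=> x xcd; rewrite big_nil mul1r hornerZ leNgt; apply/negP => neg.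
  have key u v : u \in `]c, d[ -> v \in `]c, d[ -> u <= v -> ~ p.[u] * p.[v] < 0.
    move=> ucd vcd uv /(polyrcf.poly_ivtoo uv)[z zuv rz]; apply: noroot.
    exists z => //; move: zuv ucd vcd; rewrite !in_itv/= => /andP[uz zv].
    by move=> /andP[cu _] /andP[_ vd]; rewrite (lt_trans cu uz) (lt_trans zv vd).
  have [yx|/ltW xy] := leP y x; first exact: (key y x).
  by apply: (key x y) => //; rewrite mulrC.
have [q pE] := factor_theorem _ _ rz; rewrite {}pE in spm p0 *.
have q0 : q != 0 by apply: contraNneq p0 => ->; rewrite mul0r.
have spq : (size q < m)%N.
  by move: spm; rewrite size_Mmonic ?monicXsubC// size_XsubC addn2.
have [s [us rs scd [e e0 es]]] := IH q spq q0.
(* Membership of [z] is toggled: a new [z] completes a square, and a [z] already in [s] is removed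
   because the polynomial now supplies its factor. *)
have [zs|zs] := boolP (z \in s); last first.
  exists (z :: s); split.
  - by rewrite /= zs.
  - rewrite /= rootM root_XsubC eqxx orbT/=.
    by apply: sub_all rs => x rx; rewrite rootM rx.
  - by move=> x; rewrite inE => /orP[/eqP ->//|]; exact: scd.
  exists e => // x xcd; rewrite big_cons.
  rewrite (_ : _ * _ = ('X - z%:P) ^+ 2 * (\prod_(z <- s) ('X - z%:P) * q)); last by ring.
  rewrite scalerAr hornerM mulr_ge0 ?es// horner_exp; exact: sqr_ge0.
exists (rem z s); split.
- exact: rem_uniq.
- by apply/allP => x /mem_rem /(allP rs) rx; rewrite rootM rx.
- by move=> x /mem_rem; exact: scd.
exists e => // x xcd; have := es _ xcd.
rewrite (perm_big _ (perm_to_rem zs)) big_cons/=.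
by rewrite (_ : \prod_(z <- rem z s) ('X - z%:P) * _ = ('X - z%:P) *
  \prod_(z <- rem z s) ('X - z%:P) * q)//; ring.
Qed.

Section orthogonality.
Variables (R : realType) (al be ga a : R).
Hypotheses (al1 : -1 < al) (be1 : -1 < be) (ga1 : -1 < ga) (a0 : a < 0).

Lemma aj_int0 c d : aj_itv a c d -> aj_int al be ga a c d 0 = 0.
Proof. by move=> acd; rewrite -(scale0r 0) aj_intZ// mul0r. Qed.

Lemma aj_int_orth c d n (p g : {poly R}) : aj_itv a c d ->
  (forall k, (k < n)%N -> aj_int al be ga a c d ('X^k * p) = 0) ->
  (size g <= n)%N -> aj_int al be ga a c d (g * p) = 0.
Proof.
move=> acd orth gn; rewrite -(coefK g) poly_def mulr_suml.
have : forall i : 'I_(size g), aj_int al be ga a c d ('X^i * p) = 0.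
  by move=> i; apply: orth; exact: leq_trans (ltn_ord i) gn.
move: (index_enum _) => r orth'.
elim: r => [|i r IH]; first by rewrite big_nil aj_int0.
by rewrite big_cons aj_intD// IH -scalerAl aj_intZ// orth' mulr0 addr0.
Qed.

(** With fewer than [n] sign changes, the product over them has degree below [n] and is orthogonal
    to [p], although its product with [p] has constant sign and hence a nonzero integral. *)
Lemma aj_orth_roots c d n (p : {poly R}) : aj_itv a c d -> p != 0 ->
  (forall k, (k < n)%N -> aj_int al be ga a c d ('X^k * p) = 0) ->
  exists s, [/\ uniq s, all (root p) s, {subset s <= `]c, d[} & (n <= size s)%N].
Proof.
move=> acd p0 orth.
have [s [us rs scd [e e0 es]]] := poly_sign_factor c d p0.
exists s; split=> //; rewrite leqNgt; apply/negP => sn.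
set g := \prod_(z <- s) ('X - z%:P) in es.
have : 0 < aj_int al be ga a c d (e *: (g * p)).
  apply: aj_int_gt0 => //; rewrite scaler_eq0 (negbTE e0) mulf_eq0 (negbTE p0) orbF.
  by rewrite monic_neq0// monic_prod_XsubC.
rewrite aj_intZ// (@aj_int_orth c d n)// ?mulr0 ?ltxx//.
by rewrite size_prod_XsubC.
Qed.

Lemma is_angelesco_jacobiP n (p : {poly R}) :
  is_angelesco_jacobi n al be ga a p <->
  [/\ p \is monic, size p = (2 * n).+1 &
    forall c d k, aj_itv a c d -> (k < n)%N -> aj_int al be ga a c d ('X^k * p) = 0].
Proof.
have intE c d k : aj_int al be ga a c d ('X^k * p) =
    \int[lebesgue_measure]_(x in `]c, d[) (x ^+ k * p.[x] * aj_weight al be ga a x).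
  by apply: eq_Rintegral => x _; rewrite hornerM hornerXn.
split=> [[pm ps o1 o2]|[pm ps o]]; split=> //.
- by move=> c d k [[-> ->]|[-> ->]] kn; rewrite intE; [exact: o1|exact: o2].
- by move=> k kn; rewrite -intE o//; left.
- by move=> k kn; rewrite -intE o//; right.
Qed.

(** By orthogonality a nonzero [p - q] would have at least [n] roots in each of two disjoint
    intervals, but its degree is below [2 n]. *)
Lemma is_angelesco_jacobi_uniq n (p q : {poly R}) :
  is_angelesco_jacobi n al be ga a p -> is_angelesco_jacobi n al be ga a q -> p = q.
Proof.
move=> /is_angelesco_jacobiP[pm ps po] /is_angelesco_jacobiP[qm qs qo].
apply/eqP; rewrite -subr_eq0; apply: contraT => pq0.
have spq : (size (p - q)%R <= 2 * n)%N.
  apply/leq_sizeP => j; rewrite leq_eqVlt => /predU1P[<-|nj]; last first.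
    by rewrite coefB !nth_default ?ps ?qs// subrr.
  move: pm qm; rewrite !monicE !lead_coefE ps qs/= coefB => /eqP -> /eqP ->.
  by rewrite subrr.
have orth c d : aj_itv a c d -> forall k, (k < n)%N ->
    aj_int al be ga a c d ('X^k * (p - q)) = 0.
  move=> acd k kn; rewrite mulrBr -scaleN1r aj_intD// aj_intZ// po// qo//.
  by rewrite mulr0 addr0.
have I1 : aj_itv a a 0 by left.
have I2 : aj_itv a 0 1 by right.
have [s1 [us1 rs1 s1I n1]] := aj_orth_roots I1 pq0 (orth _ _ I1).
have [s2 [us2 rs2 s2I n2]] := aj_orth_roots I2 pq0 (orth _ _ I2).
have : (size (s1 ++ s2) < size (p - q)%R)%N.
  apply: max_poly_roots => //; first by rewrite all_cat rs1.
  rewrite cat_uniq us1 us2 andbT; apply/hasPn => x /s2I; rewrite in_itv/= => /andP[x0 _].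
  apply/negP => /s1I; rewrite in_itv/= => /andP[_ x_lt0].
  by have := lt_trans x0 x_lt0; rewrite ltxx.
by rewrite ltnNge size_cat (leq_trans spq)// mul2n -addnn leq_add.
Qed.

End orthogonality.

(** * The Rodrigues formula, existence, and changes of one parameter *)

(** This is [kappa] in the overview, the leading coefficient that the Rodrigues formula produces. *)
Definition aj_factor (R : realType) (al be ga : R) (n : nat) : R :=
  (2 * n)%:R + 1 + al + be + ga.

Lemma aj_factor_gt0 (R : realType) (al be ga : R) (n : nat) :
  -1 < al -> -1 < be -> -1 < ga -> (0 < n)%N ->
  0 < aj_factor al be ga n.
Proof.
move=> al1 be1 ga1 n0; rewrite /aj_factor.
have : 2%:R <= (2 * n)%:R :> R by rewrite ler_nat; lia.
lra.
Qed.

Section rodrigues.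
Variables (R : realType) (a : R).
Hypothesis a0 : a < 0.
Implicit Types (al be ga : R) (r h : {poly R}).

(** With [w] the weight, this is [(Theta w r)' / w] written as a polynomial. *)
Definition aj_raise al be ga r : {poly R} :=
  (aj_nodes a * r)^`() + aj_slope al be ga a * r.

Lemma coef_nodesM r j : (aj_nodes a * r)`_j.+3 = r`_j - (a + 1) * r`_j.+1 + a * r`_j.+2.
Proof.
rewrite (_ : aj_nodes a = 'X^3 - (a + 1) *: 'X^2 + a *: 'X); last first.
  by rewrite /aj_nodes -!mul_polyC polyCD; ring.
rewrite mulrDl mulrBl -!scalerAl coefD coefB !coefZ !coefXnM coefXM/=.
by rewrite !subSS !subn0.
Qed.

Lemma coef_slopeM al be ga r j : (aj_slope al be ga a * r)`_j.+2 =
  (al + be + ga) * r`_j - (al * a + be + ga * (a + 1)) * r`_j.+1 + ga * a * r`_j.+2.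
Proof.
rewrite (_ : aj_slope al be ga a = (al + be + ga) *: 'X^2 -
    (al * a + be + ga * (a + 1)) *: 'X + (ga * a)%:P); last first.
  by rewrite /aj_slope -!mul_polyC !(polyCD, polyCM); ring.
rewrite mulrDl mulrBl -!scalerAl coefD coefB !coefZ coefXnM coefXM coefCM/=.
by rewrite !subSS !subn0 -mulrA.
Qed.

Lemma raise_monic al be ga n r : -1 < al -> -1 < be -> -1 < ga ->
  r \is monic -> size r = (2 * n).+1 ->
  (aj_factor al be ga n.+1)^-1 *: aj_raise al be ga r \is monic /\
  size ((aj_factor al be ga n.+1)^-1 *: aj_raise al be ga r) = (2 * n.+1).+1.
Proof.
move=> al1 be1 ga1 rm sr.
have k0 : aj_factor al be ga n.+1 != 0 by rewrite gt_eqF// aj_factor_gt0.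
have r0 j : (2 * n < j)%N -> r`_j = 0 by move=> nj; rewrite nth_default// sr.
have -> : (2 * n.+1 = (2 * n).+2)%N by lia.
apply: monic_sizeP => [|[|[|j]] nj] //; rewrite coefZ coefD coef_deriv.
(* In degree [2 n + 2] the derivative contributes [2 n + 3] and the slope term [al + be + ga]. *)
- rewrite coef_nodesM coef_slopeM (coef_monic_lead rm sr) !r0//.
  rewrite !mulr0 !subr0 !addr0 mulr1 -mulr_natr mul1r.
  have <- : aj_factor al be ga n.+1 = (2 * n).+3%:R + (al + be + ga).
    rewrite /aj_factor (_ : (2 * n).+3%:R = (2 * n.+1)%:R + 1); first by ring.
    by rewrite natr1; congr _%:R; lia.
  by rewrite mulVf.
- have nj' : (2 * n < j)%N by lia.
  rewrite coef_nodesM coef_slopeM !r0//; try lia.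
  by rewrite !mulr0 !subr0 !addr0 mul0rn mulr0.
Qed.

(** Integration by parts for [h * r]: the product rule splits its vanishing integral into these two
    terms. *)
Lemma aj_int_raise al be ga c d h r : -1 < al -> -1 < be -> -1 < ga -> aj_itv a c d ->
  aj_int al be ga a c d (h * aj_raise al be ga r) =
  - aj_int al be ga a c d (h^`() * (aj_nodes a * r)).
Proof.
move=> al1 be1 ga1 acd; apply/eqP; rewrite -subr_eq0 opprK -aj_intD//.
rewrite -[X in _ == X](aj_int_by_parts a0 acd (h * r) al1 be1 ga1).
apply/eqP; congr aj_int; rewrite /aj_raise.
rewrite (mulrCA (aj_nodes a) h r) [(h * _)^`()]derivM; ring.
Qed.

(** The raised weight is, up to sign, the original one times [aj_nodes], so this is the
    orthogonality of [r]. *)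
Lemma rodrigues_orth al be ga n r c d k : -1 < al -> -1 < be -> -1 < ga ->
  is_angelesco_jacobi n (al + 1) (be + 1) (ga + 1) a r -> aj_itv a c d ->
  (k < n)%N -> aj_int al be ga a c d ('X^k * (aj_nodes a * r)) = 0.
Proof.
move=> al1 be1 ga1.
have [al2 be2 ga2] : [/\ -1 < al + 1, -1 < be + 1 & -1 < ga + 1] by split; lra.
move=> /is_angelesco_jacobiP[_ _ orth] acd kn.
have [s s0 sE] := aj_int_shift_nodes a0 acd al1 be1 ga1.
have := orth _ _ _ acd kn; rewrite sE mulrCA => /eqP.
by rewrite mulf_eq0 (negbTE s0)/= => /eqP.
Qed.

(** For [k = 0] the factor [k%:R] is zero, so the truncated exponent [k.-1] does no harm. *)
Lemma raise_orth al be ga n r c d k : -1 < al -> -1 < be -> -1 < ga ->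
  is_angelesco_jacobi n (al + 1) (be + 1) (ga + 1) a r -> aj_itv a c d ->
  aj_int al be ga a c d ('X^k * aj_raise al be ga r) =
  - k%:R * aj_int al be ga a c d ('X^(k.-1) * (aj_nodes a * r)).
Proof.
move=> al1 be1 ga1 rP acd.
by rewrite aj_int_raise// derivXn -scaler_nat -scalerAl aj_intZ// mulNr.
Qed.

(** A moment of order [k + 1] reduces to the moment of order [k] of [r] for the raised weight, which
    vanishes; the moment of order [0] is an integrated derivative. *)
Lemma rodrigues al be ga n r : -1 < al -> -1 < be -> -1 < ga ->
  is_angelesco_jacobi n (al + 1) (be + 1) (ga + 1) a r ->
  is_angelesco_jacobi n.+1 al be ga a
    ((aj_factor al be ga n.+1)^-1 *: aj_raise al be ga r).
Proof.
move=> al1 be1 ga1 rP.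
apply/is_angelesco_jacobiP => //.
have [rm sr _ _] := rP; have [pm ps] := raise_monic al1 be1 ga1 rm sr.
split=> // c d k acd kn.
rewrite -scalerAr aj_intZ// (raise_orth _ _ _ _ rP)//.
case: k kn => [|k] kn; first by rewrite oppr0 mul0r mulr0.
by rewrite (rodrigues_orth _ _ _ rP)// !mulr0.
Qed.

(** Existence comes from the Rodrigues formula, which builds each degree from the previous one with
    raised parameters; the induction therefore ranges over all parameters. *)
Lemma angelesco_jacobi_spec al be ga n : -1 < al -> -1 < be -> -1 < ga ->
  is_angelesco_jacobi n al be ga a (angelesco_jacobi n al be ga a).
Proof.
move=> al1 be1 ga1; rewrite /angelesco_jacobi.
suff [p pP] : exists p, is_angelesco_jacobi n al be ga a p.
  by case: xgetP => [q _ //|/(_ p)].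
elim: n al be ga al1 be1 ga1 => [|n IH] al be ga al1 be1 ga1.
  by exists 1; split; rewrite ?monic1 ?size_poly1.
have [|||r rP] := IH (al + 1) (be + 1) (ga + 1); try lra.
by exists ((aj_factor al be ga n.+1)^-1 *: aj_raise al be ga r); exact: rodrigues.
Qed.

Lemma angelesco_jacobi_rodrigues al be ga n : -1 < al -> -1 < be -> -1 < ga ->
  aj_factor al be ga n.+1 *: angelesco_jacobi n.+1 al be ga a =
  aj_raise al be ga (angelesco_jacobi n (al + 1) (be + 1) (ga + 1) a).
Proof.
move=> al1 be1 ga1.
have k0 : aj_factor al be ga n.+1 != 0 by rewrite gt_eqF// aj_factor_gt0.
have rP : is_angelesco_jacobi n (al + 1) (be + 1) (ga + 1) a
    (angelesco_jacobi n (al + 1) (be + 1) (ga + 1) a).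
  by apply: angelesco_jacobi_spec; lra.
rewrite (is_angelesco_jacobi_uniq al1 be1 ga1 a0
  (angelesco_jacobi_spec n.+1 al1 be1 ga1) (rodrigues al1 be1 ga1 rP)).
by rewrite scalerA divff// scale1r.
Qed.

(* Both terms on the right, multiplied by ['X - b%:P], are orthogonal to ['X^k]
   for [k < n]; [delta] is the value that cancels the moment of order [n]. *)
Lemma angelesco_jacobi_shift al be ga al' be' ga' n b (u : {poly R}) :
  -1 < al -> -1 < be -> -1 < ga -> -1 < al' -> -1 < be' -> -1 < ga' ->
  (forall c d, aj_itv a c d -> exists2 s : R, s != 0 & forall h,
    aj_int al' be' ga' a c d h = s * aj_int al be ga a c d (('X - b%:P) * h)) ->
  aj_nodes a = ('X - b%:P) * u -> u \is monic -> size u = 3 ->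
  let delta := n.+1%:R / aj_factor al be ga n.+1 in
  (1 + delta) *: angelesco_jacobi n.+1 al' be' ga' a =
  angelesco_jacobi n.+1 al be ga a +
  delta *: (u * angelesco_jacobi n (al + 1) (be + 1) (ga + 1) a).
Proof.
move=> al1 be1 ga1 al2 be2 ga2 shift nodesE um su delta.
set k := aj_factor al be ga n.+1 in delta *.
have k0 : 0 < k by exact: aj_factor_gt0.
have d0 : 0 < 1 + delta by rewrite ltr_wpDr// divr_ge0// ltW.
set r := angelesco_jacobi n (al + 1) (be + 1) (ga + 1) a.
set p := angelesco_jacobi n.+1 al be ga a.
have rP : is_angelesco_jacobi n (al + 1) (be + 1) (ga + 1) a r.
  by apply: angelesco_jacobi_spec; lra.
have pP : is_angelesco_jacobi n.+1 al be ga a p by exact: angelesco_jacobi_spec.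
have pE : k *: p = aj_raise al be ga r by exact: angelesco_jacobi_rodrigues.
suff qP : is_angelesco_jacobi n.+1 al' be' ga' a ((1 + delta)^-1 *: (p + delta *: (u * r))).
  rewrite (is_angelesco_jacobi_uniq al2 be2 ga2 a0
    (angelesco_jacobi_spec n.+1 al2 be2 ga2) qP).
  by rewrite scalerA divff ?scale1r// gt_eqF.
apply/is_angelesco_jacobiP => //.
have [rm sr _ _] := rP; have [pm sp _ _] := pP.
have urm : u * r \is monic by rewrite monicMl.
have sur : size (u * r) = (2 * n.+1).+1.
  by rewrite size_Mmonic ?monic_neq0// su sr; lia.
suff orth c d j : aj_itv a c d -> (j < n.+1)%N ->
    aj_int al' be' ga' a c d ('X^j * ((1 + delta)^-1 *: (p + delta *: (u * r)))) = 0.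
  have [] // := @monic_sizeP _ ((1 + delta)^-1 *: (p + delta *: (u * r))) (2 * n.+1).
  - rewrite coefZ coefD coefZ !(coef_monic_lead _ sur, coef_monic_lead _ sp)//.
    by rewrite mulr1 mulVf// gt_eqF.
  - by move=> j jn; rewrite coefZ coefD coefZ !nth_default ?sp ?sur// mulr0 addr0 mulr0.
move=> acd jn; have [s s0 sE] := shift _ _ acd.
rewrite sE -!scalerAr aj_intZ//.
suff -> : aj_int al be ga a c d (('X - b%:P) * ('X^j * (p + delta *: (u * r)))) = 0.
  by rewrite !mulr0.
(* The linear factor raises the order of the moment of [p], where writing [k *: p] brings in the
   Rodrigues formula, and it completes [u] to [aj_nodes]. *)
have -> : ('X - b%:P) * ('X^j * (p + delta *: (u * r))) =
    k^-1 *: ('X^(j.+1) * (k *: p)) + ((- b) *: ('X^j * p) +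
    delta *: ('X^j * (aj_nodes a * r))).
  rewrite -scalerAr scalerA mulVf ?gt_eqF// scale1r nodesE.
  by rewrite exprS -!mul_polyC polyCN; ring.
have [_ _ porth] := (is_angelesco_jacobiP _ _ _ _ _ _).1 pP.
rewrite !aj_intD// !aj_intZ// (porth _ _ _ acd jn) mulr0 add0r.
rewrite pE (raise_orth _ _ _ _ rP)//= /delta.
(* For [j = n] the two remaining moments cancel by the choice of [delta]; for [j < n] each is
   zero. *)
move: jn; rewrite ltnS leq_eqVlt => /predU1P[->|jn].
  by field; rewrite gt_eqF.
by rewrite (rodrigues_orth _ _ _ rP)// !mulr0 addr0.
Qed.

End rodrigues.

(** * Polynomials with roots in prescribed gaps *)

Section sorted_roots.
Variable R : realType.
Implicit Types (s t u z : seq R) (p q : {poly R}) (x y : R).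

Definition root_poly s : {poly R} := \prod_(x <- s) ('X - x%:P).

Lemma root_poly_cons x s : root_poly (x :: s) = ('X - x%:P) * root_poly s.
Proof. exact: big_cons. Qed.

Lemma root_poly_cat s t : root_poly (s ++ t) = root_poly s * root_poly t.
Proof. exact: big_cat. Qed.

Lemma sorted_nth_lt s i j : sorted <%R s -> (i < size s)%N -> (j < size s)%N ->
  (s`_i < s`_j) = (i < j)%N.
Proof. by move=> ss si sj; rewrite (lt_sorted_ltn_nth 0 ss). Qed.

Lemma sorted_nth_le s i j : sorted <%R s -> (i < size s)%N -> (j < size s)%N ->
  (s`_i <= s`_j) = (i <= j)%N.
Proof. by move=> ss si sj; rewrite leNgt sorted_nth_lt// -leqNgt. Qed.

Lemma root_poly_same_sign s x y : {in s, forall w, 0 < (x - w) * (y - w)} ->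
  0 < (root_poly s).[x] * (root_poly s).[y].
Proof.
elim: s => [|v s IH] H; first by rewrite /root_poly big_nil !hornerC mulr1 ltr01.
rewrite root_poly_cons !hornerM !hornerXsubC mulrACA mulr_gt0//.
  by rewrite H// mem_head.
by apply: IH => w ws; rewrite H// inE ws orbT.
Qed.

(** Once two consecutive roots are split off, the remaining factor [V] keeps its sign on the closed
    gap, and the two linear factors decide all signs. *)
Lemma root_poly_deriv_sign s i : sorted <%R s -> (i.+1 < size s)%N ->
  (root_poly s)^`().[s`_i] * (root_poly s)^`().[s`_i.+1] < 0 /\
  {in `]s`_i, s`_i.+1[, forall x, 0 < (root_poly s)^`().[s`_i] * (root_poly s).[x]}.
Proof.
move=> ss si.
have sE : s = take i s ++ s`_i :: s`_i.+1 :: drop i.+2 s.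
  by rewrite -drop_nth// -drop_nth ?cat_take_drop// ltnW.
have si' : (i < size s)%N by exact: ltnW.
have s2 : s`_i < s`_i.+1 by rewrite sorted_nth_lt.
set V := root_poly (take i s) * root_poly (drop i.+2 s).
have TE : root_poly s = ('X - (s`_i)%:P) * (('X - (s`_i.+1)%:P) * V).
  by rewrite {1}sE root_poly_cat !root_poly_cons /V; ring.
have lo w : w \in take i s -> w < s`_i.
  move=> /(nthP 0)[j]; rewrite size_take si' => ji <-.
  by rewrite nth_take// sorted_nth_lt// (ltn_trans ji).
have hi w : w \in drop i.+2 s -> s`_i.+1 < w.
  move=> /(nthP 0)[j]; rewrite size_drop ltn_subRL => ji <-.
  by rewrite nth_drop sorted_nth_lt// addSn ltnS ltn_addr.
have VV x y : x \in `[s`_i, s`_i.+1] -> y \in `[s`_i, s`_i.+1] -> 0 < V.[x] * V.[y].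
  rewrite !in_itv/= => /andP[xl xh] /andP[yl yh].
  rewrite /V !hornerM mulrACA mulr_gt0// root_poly_same_sign// => w.
    by move=> /lo wl; rewrite mulr_gt0// subr_gt0 (lt_le_trans wl).
  by move=> /hi wh; rewrite nmulr_rgt0 subr_lt0 ?(le_lt_trans xh)// (le_lt_trans yh).
have di : s`_i \in `[s`_i, s`_i.+1] by rewrite in_itv/= lexx ltW.
have di1 : s`_i.+1 \in `[s`_i, s`_i.+1] by rewrite in_itv/= lexx ltW.
clearbody V.
have D1 : (root_poly s)^`().[s`_i] = (s`_i - s`_i.+1) * V.[s`_i].
  by rewrite TE !derivM !derivXsubC !hornerE; ring.
have D2 : (root_poly s)^`().[s`_i.+1] = (s`_i.+1 - s`_i) * V.[s`_i.+1].
  by rewrite TE !derivM !derivXsubC !hornerE; ring.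
split.
  rewrite D1 D2 mulrACA pmulr_llt0 ?VV// -opprB mulNr oppr_lt0 mulr_gt0// subr_gt0//.
move=> x xi; have /andP[xl xh] : s`_i < x < s`_i.+1 by rewrite in_itv/= in xi.
have xc : x \in `[s`_i, s`_i.+1] by rewrite in_itv/= !ltW.
rewrite D1 TE !hornerM !hornerXsubC.
rewrite [ltRHS](_ : _ = ((s`_i.+1 - s`_i) * (x - s`_i) * (s`_i.+1 - x)) *
  (V.[s`_i] * V.[x])); last by ring.
by apply: mulr_gt0; [rewrite !mulr_gt0 ?subr_gt0|exact: VV].
Qed.

(** In the applications [z] lists the zeros of [T], and [t] those of a polynomial of degree one
    less. *)
Definition gaps z t : Prop :=
  size z = (size t).+1 /\ forall i, (i < size t)%N -> z`_i < t`_i < z`_i.+1.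

Lemma gaps_sorted z t : gaps z t -> sorted <%R t.
Proof.
move=> [_ H]; apply/(sortedP 0) => i si.
have /andP[_ h1] := H _ (ltnW si); have /andP[h2 _] := H _ si.
exact: lt_trans h1 h2.
Qed.

(** The intermediate value theorem gives a root in each gap. There are as many gaps as the degree,
    so these are all the roots. *)
Lemma alternating_roots z p : p \is monic -> size p = size z ->
  (forall i, (i.+1 < size z)%N -> p.[z`_i] * p.[z`_i.+1] < 0) -> sorted <%R z ->
  exists2 t, gaps z t & p = root_poly t.
Proof.
move=> pm sp alt sz.
have z0 : (0 < size z)%N by rewrite -sp size_poly_gt0 monic_neq0.
have /choice[f fP] : forall i, exists y, (i.+1 < size z)%N ->
    z`_i < y < z`_i.+1 /\ root p y.
  move=> i; have [si|] := boolP (i.+1 < size z)%N; last by exists 0.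
  have le : z`_i <= z`_i.+1 by rewrite sorted_nth_le// ltnW.
  by have [x xi rx] := polyrcf.poly_ivtoo le (alt i si); exists x; rewrite in_itv in xi.
pose t := mkseq f (size z).-1.
have st : size z = (size t).+1 by rewrite size_mkseq prednK.
have gzt : gaps z t.
  split=> // i it; rewrite nth_mkseq; last by rewrite size_mkseq in it.
  by have [] := fP i; rewrite ?st.
exists t => //.
rewrite [LHS](@all_roots_prod_XsubC _ p t) ?sp ?st//.
- by move: pm; rewrite monicE => /eqP ->; rewrite scale1r.
- apply/allP => x /(nthP 0)[i it <-].
  rewrite nth_mkseq; last by rewrite size_mkseq in it.
  by have [] := fP i; rewrite // st.
- by rewrite uniq_rootsE lt_sorted_uniq// (gaps_sorted gzt).
Qed.

Lemma gaps_index z t i j : sorted <%R z -> gaps z t ->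
  (i < size t)%N -> (j < size t)%N -> z`_i < t`_j < z`_i.+1 -> j = i.
Proof.
move=> sz [szt H] it jt /andP[h1 h2].
have /andP[h3 h4] := H _ jt.
have := lt_trans h3 h2; have := lt_trans h1 h4.
rewrite !sorted_nth_lt ?szt ?ltnS// ?(ltnW it, ltnW jt)//; try exact: ltnW.
by move=> ? ?; lia.
Qed.

(** In this gap [root_poly u] has a single root, so its sign at [x], compared with that at the left
    end, tells on which side of [x] the root lies. *)
Lemma gap_root_compare z u i x : sorted <%R z -> gaps z u -> (i < size u)%N ->
  (root_poly u).[z`_i] * (root_poly u).[z`_i.+1] < 0 -> z`_i < x < z`_i.+1 ->
  (0 < (root_poly u).[z`_i] * (root_poly u).[x] -> x < u`_i) /\
  ((root_poly u).[z`_i] * (root_poly u).[x] < 0 -> u`_i < x).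
Proof.
move=> sz gzu iu alt /andP[x1 x2].
have key y : z`_i < y < z`_i.+1 -> root (root_poly u) y -> y = u`_i.
  rewrite root_prod_XsubC => yi /(nthP 0)[j ju E].
  by rewrite -E in yi *; rewrite (gaps_index sz gzu iu ju yi).
set q := root_poly u in alt key *.
split=> qx.
- have neg : q.[x] * q.[z`_i.+1] < 0.
    have : (q.[z`_i] * q.[x]) * (q.[z`_i] * q.[z`_i.+1]) < 0 by rewrite pmulr_rlt0.
    rewrite [ltLHS](_ : _ = q.[z`_i] ^+ 2 * (q.[x] * q.[z`_i.+1])); last by ring.
    rewrite pmulr_rlt0// lt_def sqr_ge0 andbT sqrf_eq0.
    by apply: contraTneq qx => ->; rewrite mul0r ltxx.
  have [y] := polyrcf.poly_ivtoo (ltW x2) neg; rewrite in_itv/= => /andP[xy y2] ry.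
  by rewrite -(key y)// (lt_trans x1 xy) y2.
- have [y] := polyrcf.poly_ivtoo (ltW x1) qx; rewrite in_itv/= => /andP[y1 yx] ry.
  by rewrite -(key y)// y1 (lt_trans yx x2).
Qed.

(** The derivative of [root_poly z] alternates in sign along its roots, and [q] copies these
    signs. *)
Lemma same_sign_alternating z q : sorted <%R z ->
  (forall i, (i < size z)%N -> 0 < q.[z`_i] * (root_poly z)^`().[z`_i]) ->
  forall i, (i.+1 < size z)%N -> q.[z`_i] * q.[z`_i.+1] < 0.
Proof.
move=> sz pos i si; have [alt _] := root_poly_deriv_sign sz si.
have := mulr_gt0 (pos i (ltnW si)) (pos _ si).
by rewrite mulrACA nmulr_lgt0.
Qed.

(* At a zero [x] of [root_poly t] the relation reads
   [(1 + delta) (x - c) (root_poly u).[x] = delta (root_poly z).[x]], so the sign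
   of [x - c] tells whether [root_poly u] has already changed sign in the gap. *)
Lemma gaps_compare z t u c delta : sorted <%R z -> gaps z t -> gaps z u ->
  0 < delta ->
  (forall i, (i < size z)%N -> 0 < (root_poly u).[z`_i] * (root_poly z)^`().[z`_i]) ->
  (1 + delta) *: (('X - c%:P) * root_poly u) =
    ('X - c%:P) * root_poly t + delta *: root_poly z ->
  forall i, (i < size t)%N -> (c < t`_i -> t`_i < u`_i) /\ (t`_i < c -> u`_i < t`_i).
Proof.
move=> sz [szt gt] gzu d0 pos rel i it.
have iz : (i.+1 < size z)%N by rewrite szt.
have iu : (i < size u)%N by rewrite -ltnS -gzu.1 szt.
have xi := gt _ it.
have [_ /(_ t`_i)] := root_poly_deriv_sign sz iz; rewrite in_itv/= => /(_ xi) Tx.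
have [cmp1 cmp2] := gap_root_compare sz gzu iu (same_sign_alternating sz pos iz) xi.
have := congr1 (horner^~ t`_i) rel.
rewrite /= !(hornerXsubC, hornerZ, hornerD, hornerM).
have /rootP -> : root (root_poly t) t`_i by rewrite root_prod_XsubC mem_nth.
rewrite mulr0 add0r => E.
have qT : 0 < ((t`_i - c) * (root_poly u).[t`_i]) * (root_poly z)^`().[z`_i].
  have : 0 < (1 + delta) * ((t`_i - c) * (root_poly u).[t`_i]) * (root_poly z)^`().[z`_i].
    by rewrite E mulrAC -mulrA mulr_gt0.
  by rewrite -mulrA pmulr_rgt0// addr_gt0.
have := mulr_gt0 qT (pos _ (ltnW iz)).
set D := (root_poly z)^`().[z`_i]; set q := root_poly u.
rewrite [ltRHS](_ : _ = D ^+ 2 * ((t`_i - c) * (q.[z`_i] * q.[t`_i]))); last by ring.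
rewrite pmulr_rgt0; last first.
  rewrite lt_def sqr_ge0 andbT sqrf_eq0; apply: contraTneq Tx => D0.
  by rewrite -/D D0 mul0r ltxx.
move=> qq; split=> ci.
- by apply: cmp1; rewrite pmulr_rgt0 ?subr_gt0 in qq.
- by apply: cmp2; rewrite nmulr_rgt0 ?subr_lt0 in qq.
Qed.

(** Roots inside an interval form a contiguous block of the sorted list, here the [m] indices
    starting at [k]. *)
Lemma simple_zeros_slice (I : interval R) s k m : sorted <%R s ->
  (k + m <= size s)%N ->
  (forall i, (i < size s)%N -> (s`_i \in I) = (k <= i < k + m)%N) ->
  simple_zeros_in I (root_poly s) (take m (drop k s)).
Proof.
move=> ss kms sI.
have szd : (m <= size (drop k s))%N by rewrite size_drop; lia.
have mem x : (x \in take m (drop k s)) = (x \in I) && root (root_poly s) x.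
  rewrite root_prod_XsubC; apply/idP/andP.
    move=> xs; have xss := mem_drop (mem_take xs).
    split=> //; move: xs => /(nthP 0)[i]; rewrite size_takel// => im <-.
    by rewrite nth_take// nth_drop sI; lia.
  move=> [xI /(nthP 0)[i si E]]; rewrite -E sI// in xI *.
  apply/(nthP 0); exists (i - k)%N; first by rewrite size_takel//; lia.
  rewrite nth_take; last lia.
  by rewrite nth_drop subnKC//; lia.
split=> //.
- by apply: take_sorted; apply: drop_sorted.
- move=> x; rewrite mem => /andP[_]; rewrite root_prod_XsubC => xs.
  by rewrite mu_prod_XsubC count_uniq_mem ?lt_sorted_uniq// xs.
Qed.

(** The offsets [k] and [k'] are separate because the two polynomials may have different numbers of
    zeros to the left of [I]. *)
Lemma interlaces_slice (I : interval R) s t k m k' m' :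
  sorted <%R s -> sorted <%R t -> (k + m <= size s)%N -> (k' + m' <= size t)%N ->
  (forall i, (i < size s)%N -> (s`_i \in I) = (k <= i < k + m)%N) ->
  (forall i, (i < size t)%N -> (t`_i \in I) = (k' <= i < k' + m')%N) ->
  m' = m \/ m = m'.+1 ->
  (forall i, (i < m')%N -> s`_(k + i) < t`_(k' + i)) ->
  (forall i, (i.+1 < m)%N -> t`_(k' + i) < s`_(k + i.+1)) ->
  interlaces I (root_poly s) (root_poly t).
Proof.
move=> ss st ks kt sI tI mm h1 h2.
exists (take m (drop k s)), (take m' (drop k' t)).
have sz1 : size (take m (drop k s)) = m by rewrite size_takel// size_drop; lia.
have sz2 : size (take m' (drop k' t)) = m' by rewrite size_takel// size_drop; lia.
split; rewrite ?sz1 ?sz2//.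
- exact: simple_zeros_slice.
- exact: simple_zeros_slice.
- by move=> i im; rewrite !nth_take ?nth_drop//; [exact: h1|lia].
- by move=> i im; rewrite !nth_take ?nth_drop//; [exact: h2|lia].
Qed.

Lemma interlaces_line s t : sorted <%R s -> sorted <%R t -> size t = size s ->
  (forall i, (i < size s)%N -> s`_i < t`_i) ->
  (forall i, (i.+1 < size s)%N -> t`_i < s`_i.+1) ->
  interlaces `]-oo, +oo[ (root_poly s) (root_poly t).
Proof.
move=> ss st sts h1 h2.
apply: (@interlaces_slice _ s t 0 (size s) 0 (size s)); rewrite ?add0n ?sts//.
by left.
Qed.

End sorted_roots.

(** * Zeros of Angelesco-Jacobi polynomials *)

(** At entries of [z] other than [b] the polynomial [w] vanishes, so [q] has the sign of
    [root_poly t]; at [b], [w] equals the derivative of [root_poly z] and reinforces that sign.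
    Hence [q] alternates too. *)
Lemma shifted_zeros (R : realType) (z t : seq R) (b delta : R) (q w : {poly R}) :
  sorted <%R z -> gaps z t -> q \is monic -> size q = size z -> 0 < delta ->
  root_poly z = ('X - b%:P) * w ->
  (1 + delta) *: q = root_poly t + delta *: w ->
  (forall i, (i < size z)%N -> 0 < (root_poly t).[z`_i] * (root_poly z)^`().[z`_i]) ->
  exists u, [/\ gaps z u, q = root_poly u & forall i, (i < size t)%N ->
    (b < t`_i -> t`_i < u`_i) /\ (t`_i < b -> u`_i < t`_i)].
Proof.
move=> sz gzt qm sq d0 zE rel pos.
have d1 : 0 < 1 + delta by rewrite addr_gt0.
have qpos i : (i < size z)%N -> 0 < q.[z`_i] * (root_poly z)^`().[z`_i].
  move=> iz; rewrite -(pmulr_rgt0 _ d1) mulrA.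
  have -> : (1 + delta) * q.[z`_i] = (root_poly t).[z`_i] + delta * w.[z`_i].
    by have := congr1 (horner^~ z`_i) rel; rewrite /= hornerD !hornerZ.
  rewrite mulrDl ltr_wpDr ?pos// -mulrA mulr_ge0 ?(ltW d0)//.
  have [->|zb] := eqVneq z`_i b.
    rewrite zE derivM derivXsubC !hornerE ?subrr ?mul0r ?addr0 ?mul1r -expr2.
    exact: sqr_ge0.
  have : (root_poly z).[z`_i] = 0 by apply/rootP; rewrite root_prod_XsubC mem_nth.
  rewrite {1}zE hornerM hornerXsubC => /eqP.
  by rewrite mulf_eq0 subr_eq0 (negbTE zb)/= => /eqP ->; rewrite mul0r.
have [u gzu uE] := alternating_roots qm sq (same_sign_alternating sz qpos) sz.
exists u; split=> //.
apply: (@gaps_compare _ z t u b delta) => //; first by rewrite -uE.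
by rewrite -uE zE !scalerAr -mulrDr rel.
Qed.

(** * The zeros of [T] and the gaps between them *)

Section node_list.
Variables (R : realType) (a : R) (n : nat) (l m : seq R).
Hypotheses (a0 : a < 0) (sl : size l = n) (sm : size m = n)
  (ltl : sorted <%R l) (ltm : sorted <%R m)
  (lI : {subset l <= `]a, 0[}) (mI : {subset m <= `]0, 1[}).

(** With [l] and [m] the zeros of [r] in the two intervals, these are the zeros of [T] in increasing
    order. The entry [0] has index [n + 1], and the entry [1] has index [2 n + 2]. *)
Definition node_list : seq R := a :: l ++ 0 :: rcons m 1.

Lemma size_node_list : size node_list = (2 * n.+1).+1.
Proof. by rewrite /= size_cat/= size_rcons sl sm mul2n -addnn addSn !addnS. Qed.

Lemma node_list_sorted : sorted <%R node_list.
Proof.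
have lP x : x \in l -> a < x < 0 by move=> /lI; rewrite in_itv.
have mP x : x \in m -> 0 < x < 1 by move=> /mI; rewrite in_itv.
have rP x : x \in rcons m 1 -> 0 < x.
  by rewrite mem_rcons inE => /predU1P[->|/mP/andP[]].
rewrite lt_sorted_pairwise /node_list pairwise_cons pairwise_cat pairwise_cons.
rewrite pairwise_rcons -!lt_sorted_pairwise ltl ltm andbT/=.
apply/and4P; split; apply/allP => x.
- rewrite mem_cat inE => /or3P[/lP/andP[]//|/eqP ->//|/rP].
  exact: lt_trans.
- move=> /lP/andP[_ x0]; rewrite /= x0/=; apply/allP => y /rP; exact: lt_trans.
- exact: rP.
- by move=> /mP/andP[].
Qed.

Lemma node_list_mid : node_list`_n.+1 = 0.
Proof. by rewrite /= nth_cat sl ltnn subnn. Qed.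

Lemma node_list_last : node_list`_(2 * n.+1) = 1.
Proof.
rewrite mul2n -addnn addSn /= nth_cat sl ltnNge leq_addr/= addKn/=.
by rewrite nth_rcons sm ltnn eqxx.
Qed.

Lemma node_listE (r : {poly R}) : r = root_poly (l ++ m) ->
  aj_nodes a * r = root_poly node_list.
Proof.
move=> ->; rewrite /node_list -cats1 !(root_poly_cons, root_poly_cat).
by rewrite /aj_nodes /root_poly big_nil subr0; ring.
Qed.

Lemma node_listP x : x \in node_list ->
  x \in [:: a; 0; 1] \/ [/\ x \in l ++ m, x != a, x != 0 & x != 1].
Proof.
rewrite /node_list !(inE, mem_cat, mem_rcons) -/(_ \in _).
have [->|xa] := eqVneq x a; first by left.
have [->|x0] := eqVneq x 0; first by left; rewrite orbT.
have [->|x1] := eqVneq x 1; first by left; rewrite !orbT.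
by rewrite /= => H; right; split.
Qed.

(** Each entry of [t] lies between two nodes of known index, so comparison with any node is a
    comparison of indices. *)
Lemma gaps_nodeP t k i : gaps node_list t -> (i < size t)%N -> (k <= size t)%N ->
  (node_list`_k < t`_i) = (k <= i)%N /\ (t`_i < node_list`_k) = (i < k)%N.
Proof.
move=> [szt H] it kt; have /andP[h1 h2] := H _ it.
have kz : (k < size node_list)%N by rewrite szt ltnS.
have iz : (i.+1 < size node_list)%N by rewrite szt ltnS.
have [ki|ik] := leqP k i.
  have lt : node_list`_k < t`_i.
    by apply: le_lt_trans h1; rewrite sorted_nth_le ?node_list_sorted// ltnW.
  by split=> //; apply/negbTE; rewrite -leNgt ltW.
have lt : t`_i < node_list`_k.
  by apply: lt_le_trans h2 _; rewrite sorted_nth_le ?node_list_sorted.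
by split=> //; apply/negbTE; rewrite -leNgt ltW.
Qed.

(** Exactly [n + 1] gaps lie left of the node [0]. The range is written with offset [0] to match
    [interlaces_slice]. *)
Lemma gaps_left t i : gaps node_list t -> (i < size t)%N ->
  (t`_i \in `]a, 0[) = (0 <= i < 0 + n.+1)%N.
Proof.
move=> gt it; have st : size t = (2 * n.+1)%N.
  by case: gt => + _; rewrite size_node_list => -[].
have [h1 _] := gaps_nodeP gt it (leq0n _).
have [|_ h2] := @gaps_nodeP t n.+1 i gt it; first by rewrite st; lia.
by rewrite node_list_mid in h2; rewrite in_itv/= (h1 : (a < _) = _) h2.
Qed.

Lemma gaps_right t i : gaps node_list t -> (i < size t)%N ->
  (t`_i \in `]0, 1[) = (n.+1 <= i < n.+1 + n.+1)%N.
Proof.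
move=> gt it; have st : size t = (2 * n.+1)%N.
  by case: gt => + _; rewrite size_node_list => -[].
have [|h1 _] := @gaps_nodeP t n.+1 i gt it; first by rewrite st; lia.
have [|_ h2] := @gaps_nodeP t (2 * n.+1) i gt it; first by rewrite st.
rewrite node_list_mid in h1; rewrite node_list_last in h2.
by rewrite in_itv/= h1 h2 addnn -mul2n.
Qed.

End node_list.

Section zeros.
Variables (R : realType) (a : R).
Hypothesis a0 : a < 0.
Implicit Types al be ga : R.

(* At a zero [z] of [T := aj_nodes * r] the Rodrigues formula gives
   [kappa p(z) = (1 + e) T'(z)], where [e] is the exponent of the weight at [z] if
   [z] is one of [a, 0, 1], and [e = 0] otherwise. *)
Lemma rodrigues_sign al be ga n (l m : seq R) (r p : {poly R}) :
  -1 < al -> -1 < be -> -1 < ga -> size l = n -> size m = n ->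
  sorted <%R l -> sorted <%R m -> {subset l <= `]a, 0[} -> {subset m <= `]0, 1[} ->
  r = root_poly (l ++ m) -> aj_factor al be ga n.+1 *: p = aj_raise a al be ga r ->
  forall i, (i < size (node_list a l m))%N ->
  0 < p.[(node_list a l m)`_i] * (root_poly (node_list a l m))^`().[(node_list a l m)`_i].
Proof.
move=> al1 be1 ga1 sl sm ltl ltm lI mI rE pE i iz.
set z := node_list a l m in iz *.
have sz : sorted <%R z := node_list_sorted a0 ltl ltm lI mI.
have szz : size z = (2 * n.+1).+1 := size_node_list a sl sm.
have TE : aj_nodes a * r = root_poly z := node_listE a rE.
have k0 : 0 < aj_factor al be ga n.+1 by exact: aj_factor_gt0.
(* The derivative changes sign strictly between neighbouring nodes: the next node serves for the
   first, the preceding one for the others. *)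
have T0 : (root_poly z)^`().[z`_i] != 0.
  case: i iz => [|i] iz.
    have [|H _] := @root_poly_deriv_sign _ z 0 sz; first by rewrite szz; lia.
    by apply: contraTneq H => ->; rewrite mul0r ltxx.
  have [H _] := @root_poly_deriv_sign _ z i sz iz.
  by apply: contraTneq H => ->; rewrite mulr0 ltxx.
suff [e e0 E] : exists2 e, 0 < e &
    (aj_raise a al be ga r).[z`_i] = e * (root_poly z)^`().[z`_i].
  rewrite -(pmulr_rgt0 _ k0) mulrA.
  have -> : aj_factor al be ga n.+1 * p.[z`_i] = e * (root_poly z)^`().[z`_i].
    by rewrite -E -pE hornerZ.
  rewrite -mulrA pmulr_rgt0//.
  by rewrite lt_def mulf_neq0// sqr_ge0.
have := mem_nth 0 iz; move: z`_i {T0 iz} => x /node_listP [].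
- rewrite -TE !inE => /or3P[]/eqP ->.
  + exists (1 + be); first by lra.
    rewrite /aj_raise /aj_slope /aj_nodes !derivM !derivXsubC derivX !hornerE /=; ring.
  + exists (1 + ga); first by lra.
    rewrite /aj_raise /aj_slope /aj_nodes !derivM !derivXsubC derivX !hornerE /=; ring.
  + exists (1 + al); first by lra.
    rewrite /aj_raise /aj_slope /aj_nodes !derivM !derivXsubC derivX !hornerE /=; ring.
- move=> [xlm _ _ _]; exists 1 => //.
  have /rootP rx : root r x by rewrite rE root_prod_XsubC.
  by rewrite /aj_raise hornerD hornerM rx mulr0 addr0 mul1r TE.
Qed.

(** In the induction step the zeros of [r] determine the nodes. The next polynomial alternates in
    sign there, so it has one zero in each of the [2 n + 2] gaps, half of them on each side of
    [0]. *)
Lemma angelesco_jacobi_zeros al be ga n : -1 < al -> -1 < be -> -1 < ga ->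
  exists l m : seq R, [/\ size l = n /\ size m = n,
    sorted <%R l, sorted <%R m, {subset l <= `]a, 0[} /\ {subset m <= `]0, 1[} &
    angelesco_jacobi n al be ga a = root_poly (l ++ m)].
Proof.
elim: n al be ga => [|n IH] al be ga al1 be1 ga1.
  exists [::], [::]; split=> //.
  have [pm ps _ _] := angelesco_jacobi_spec a0 0 al1 be1 ga1.
  have p0 := coef_monic_lead pm ps.
  by rewrite /root_poly big_nil (size1_polyC (eq_leq ps)) p0.
have [|||l [m [[sl sm] ltl ltm [lI mI] rE]]] := IH (al + 1) (be + 1) (ga + 1); try lra.
have pos := rodrigues_sign al1 be1 ga1 sl sm ltl ltm lI mI rE
  (angelesco_jacobi_rodrigues a0 n al1 be1 ga1).
have sz := node_list_sorted a0 ltl ltm lI mI.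
have [pm ps _ _] := angelesco_jacobi_spec a0 n.+1 al1 be1 ga1.
have [|t gt tE] := alternating_roots pm _ (same_sign_alternating sz pos) sz.
  by rewrite ps (size_node_list a sl sm).
have st : size t = (2 * n.+1)%N.
  by case: (gt) => + _; rewrite (size_node_list a sl sm) => -[].
have ts := gaps_sorted gt.
exists (take n.+1 t), (drop n.+1 t); split.
- by rewrite size_takel ?size_drop st; lia.
- exact: take_sorted.
- exact: drop_sorted.
- split=> x /(nthP 0)[i].
    rewrite size_takel ?st; last by lia.
    by move=> ilt <-; rewrite nth_take// (gaps_left a0 sl sm ltl ltm lI mI gt)// st; lia.
  rewrite size_drop st => ilt <-.
  by rewrite nth_drop (gaps_right a0 sl sm ltl ltm lI mI gt) ?st; lia.
- by rewrite cat_take_drop.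
Qed.


(** A node separates consecutive gaps, so an entry of [t] always precedes the entry of [s] in the
    next gap; only the comparison within each gap has to be supplied. *)
Lemma interlaces_gaps_node n (l m : seq R) s t : size l = n -> size m = n ->
  sorted <%R l -> sorted <%R m -> {subset l <= `]a, 0[} -> {subset m <= `]0, 1[} ->
  gaps (node_list a l m) s -> gaps (node_list a l m) t ->
  ((forall i, (i < 2 * n.+1)%N -> s`_i < t`_i) ->
    interlaces `]-oo, +oo[ (root_poly s) (root_poly t)) /\
  ((forall i, (i < n.+1)%N -> s`_i < t`_i) ->
    interlaces `]a, 0[ (root_poly s) (root_poly t)) /\
  ((forall i, (i < n.+1)%N -> s`_(n.+1 + i) < t`_(n.+1 + i)) ->
    interlaces `]0, 1[ (root_poly s) (root_poly t)).
Proof.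
move=> sl sm ltl ltm lI mI gs gt.
have szE := size_node_list a sl sm.
have ss : size s = (2 * n.+1)%N by case: (gs) => + _; rewrite szE => -[].
have st : size t = (2 * n.+1)%N by case: (gt) => + _; rewrite szE => -[].
have step i : (i.+1 < 2 * n.+1)%N -> t`_i < s`_i.+1.
  move=> iN; apply: (@lt_trans _ _ (node_list a l m)`_i.+1).
    by have [_ /(_ i)] := gt; rewrite st (ltnW iN) => /(_ isT)/andP[].
  by have [_ /(_ i.+1)] := gs; rewrite ss iN => /(_ isT)/andP[].
have [ssort tsort] := (gaps_sorted gs, gaps_sorted gt).
split; [|split] => H.
- by apply: interlaces_line; rewrite ?ss ?st.
- apply: (@interlaces_slice _ _ s t 0 n.+1 0 n.+1); rewrite ?ss ?st//; try lia.
  + by move=> i iN; rewrite (gaps_left a0 sl sm ltl ltm lI mI gs)// ss.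
  + by move=> i iN; rewrite (gaps_left a0 sl sm ltl ltm lI mI gt)// st.
  + by move=> i iN; rewrite !add0n; apply: step; lia.
- apply: (@interlaces_slice _ _ s t n.+1 n.+1 n.+1 n.+1); rewrite ?ss ?st//; try lia.
  + by move=> i iN; rewrite (gaps_right a0 sl sm ltl ltm lI mI gs)// ss.
  + by move=> i iN; rewrite (gaps_right a0 sl sm ltl ltm lI mI gt)// st.
  + by move=> i iN; rewrite addnS; apply: step; lia.
Qed.

(** Dropping the node [1], or the node [a], leaves the zeros of the two products on the whole line.
    Within each interval, [n + 1] zeros of [root_poly t] enclose [n] zeros of
    [root_poly (l ++ m)]. *)
Lemma interlaces_node n (l m : seq R) t : size l = n -> size m = n ->
  sorted <%R l -> sorted <%R m -> {subset l <= `]a, 0[} -> {subset m <= `]0, 1[} ->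
  gaps (node_list a l m) t ->
  [/\ interlaces `]-oo, +oo[ ('X * ('X - a%:P) * root_poly (l ++ m)) (root_poly t),
     interlaces `]-oo, +oo[ (root_poly t) ('X * ('X - 1%:P) * root_poly (l ++ m)),
     interlaces `]a, 0[ (root_poly t) (root_poly (l ++ m)) &
     interlaces `]0, 1[ (root_poly t) (root_poly (l ++ m))].
Proof.
move=> sl sm ltl ltm lI mI gt.
have szE := size_node_list a sl sm.
have zs := node_list_sorted a0 ltl ltm lI mI.
have st : size t = (2 * n.+1)%N by case: (gt) => + _; rewrite szE => -[].
have ts := gaps_sorted gt.
have lo i : (i < 2 * n.+1)%N -> (node_list a l m)`_i < t`_i.
  by move=> iN; have [_ /(_ i)] := gt; rewrite st iN => /(_ isT)/andP[].
have hi i : (i < 2 * n.+1)%N -> t`_i < (node_list a l m)`_i.+1.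
  by move=> iN; have [_ /(_ i)] := gt; rewrite st iN => /(_ isT)/andP[].
have lms : sorted <%R (l ++ m).
  have : sorted <%R (l ++ 0 :: rcons m 1) by exact: (path_sorted zs).
  apply: subseq_sorted; first exact: lt_trans.
  rewrite cat_subseq// (subseq_trans (subseq_rcons m 1))//; exact: subseq_cons.
have nthl i : (i < n)%N -> (l ++ m)`_i = (node_list a l m)`_i.+1.
  by move=> iN; rewrite /= !nth_cat sl iN.
have nthr i : (i < n)%N -> (l ++ m)`_(n + i) = (node_list a l m)`_(n + i).+2.
  move=> iN; rewrite -addnS /= !nth_cat sl !ltnNge !leq_addr/= !addKn/=.
  by rewrite nth_rcons sm iN.
have slm : size (l ++ m) = (2 * n)%N by rewrite size_cat sl sm; lia.
have lmI i : (i < 2 * n)%N -> ((l ++ m)`_i \in `]a, 0[) = (0 <= i < 0 + n)%N /\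
    ((l ++ m)`_i \in `]0, 1[) = (n <= i < n + n)%N.
  move=> iN; rewrite nth_cat sl; case: ltnP => ni.
    have /lI : l`_i \in l by rewrite mem_nth// sl.
    move=> H; rewrite H; split; first by lia.
    apply/negbTE/negP => H'.
    move: H H'; rewrite !in_itv/= => /andP[_ h1] /andP[h2 _].
    by have := lt_trans h1 h2; rewrite ltxx.
  have /mI : m`_(i - n) \in m by rewrite mem_nth// sm; lia.
  move=> H; rewrite H; split; last by lia.
  apply/negbTE/negP => H'.
  move: H H'; rewrite !in_itv/= => /andP[h1 _] /andP[_ h2].
  by have := lt_trans h1 h2; rewrite ltxx.
split.
- have zE : node_list a l m = rcons (a :: l ++ 0 :: m) 1.
    by rewrite /node_list rcons_cons rcons_cat.
  have sE : size (a :: l ++ 0 :: m) = (2 * n.+1)%N.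
    by apply: succn_inj; rewrite -szE zE size_rcons.
  have nE i : (i < 2 * n.+1)%N -> (a :: l ++ 0 :: m)`_i = (node_list a l m)`_i.
    by move=> iN; rewrite zE nth_rcons sE iN.
  rewrite (_ : _ * root_poly (l ++ m) = root_poly (a :: l ++ 0 :: m)); last first.
    by rewrite !(root_poly_cons, root_poly_cat) subr0; ring.
  apply: interlaces_line => //; rewrite ?sE ?st//.
  + move: zs; rewrite zE; apply: subseq_sorted; first exact: lt_trans.
    exact: subseq_rcons.
  + by move=> i iN; rewrite nE// lo.
  + by move=> i iN; rewrite nE// hi// ltnW.
- have nE i : (l ++ 0 :: rcons m 1)`_i = (node_list a l m)`_i.+1 by [].
  rewrite (_ : _ * root_poly (l ++ m) = root_poly (l ++ 0 :: rcons m 1)); last first.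
    by rewrite -cats1 !(root_poly_cons, root_poly_cat) /root_poly big_nil subr0; ring.
  apply: interlaces_line => //; rewrite ?st//.
  + exact: (path_sorted zs).
  + exact: succn_inj szE.
  + by move=> i iN; rewrite nE lo.
- apply: (@interlaces_slice _ _ t (l ++ m) 0 n.+1 0 n); rewrite ?st ?slm//; try lia.
  + by move=> i iN; rewrite (gaps_left a0 sl sm ltl ltm lI mI gt)// st.
  + by move=> i /lmI[].
  + by move=> i iN; rewrite !add0n nthl// hi//; lia.
  + by move=> i iN; rewrite !add0n nthl// lo//; lia.
- apply: (@interlaces_slice _ _ t (l ++ m) n.+1 n.+1 n n); rewrite ?st ?slm//; try lia.
  + by move=> i iN; rewrite (gaps_right a0 sl sm ltl ltm lI mI gt)// st.
  + by move=> i /lmI[].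
  + by move=> i iN; rewrite nthr// addSn hi//; lia.
  + by move=> i iN; rewrite nthr// addSn addnS lo//; lia.
Qed.

(** The shift identity has the form treated in [shifted_zeros], where [w] is [u] times the
    polynomial with raised parameters and [u] is the cofactor of [X - b] in [aj_nodes]. *)
Lemma shifted_jacobi_zeros al be ga al' be' ga' n b (u : {poly R}) (l m t : seq R) :
  -1 < al -> -1 < be -> -1 < ga -> -1 < al' -> -1 < be' -> -1 < ga' ->
  (forall c d, aj_itv a c d -> exists2 s : R, s != 0 & forall h,
    aj_int al' be' ga' a c d h = s * aj_int al be ga a c d (('X - b%:P) * h)) ->
  aj_nodes a = ('X - b%:P) * u -> u \is monic -> size u = 3 ->
  size l = n -> size m = n -> sorted <%R l -> sorted <%R m ->
  {subset l <= `]a, 0[} -> {subset m <= `]0, 1[} ->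
  angelesco_jacobi n (al + 1) (be + 1) (ga + 1) a = root_poly (l ++ m) ->
  gaps (node_list a l m) t -> angelesco_jacobi n.+1 al be ga a = root_poly t ->
  exists v, [/\ gaps (node_list a l m) v,
    angelesco_jacobi n.+1 al' be' ga' a = root_poly v &
    forall i, (i < 2 * n.+1)%N -> (b < t`_i -> t`_i < v`_i) /\ (t`_i < b -> v`_i < t`_i)].
Proof.
move=> al1 be1 ga1 al2 be2 ga2 shift nodesE um su sl sm ltl ltm lI mI rE gt tE.
have st : size t = (2 * n.+1)%N.
  by case: (gt) => + _; rewrite (size_node_list a sl sm) => -[].
have [qm sq _ _] := angelesco_jacobi_spec a0 n.+1 al2 be2 ga2.
have := angelesco_jacobi_shift a0 n al1 be1 ga1 al2 be2 ga2 shift nodesE um su.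
have pos := rodrigues_sign al1 be1 ga1 sl sm ltl ltm lI mI rE
  (angelesco_jacobi_rodrigues a0 n al1 be1 ga1).
rewrite tE in pos * => rel; rewrite -st.
apply: shifted_zeros rel pos => //.
- exact: node_list_sorted.
- by rewrite sq (size_node_list a sl sm).
- by rewrite divr_gt0 ?ltr0n// aj_factor_gt0.
- by rewrite -(node_listE a rE) nodesE mulrA.
Qed.

End zeros.

(** * Effect of raising one parameter on the zeros *)

Unset Implicit Arguments.

Theorem theorem2p2 (R : realType) (alpha beta gamma a : R) (n : nat)
    (halpha : -1 < alpha) (hbeta : -1 < beta) (hgamma : -1 < gamma)
    (ha : a < 0) (hn : (2 <= n)%N) :
  [/\
      interlaces `]-oo, +oo[
        ('X * ('X - a%:P)
           * angelesco_jacobi n.-1 (alpha + 1) (beta + 1) (gamma + 1) a)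
        (angelesco_jacobi n (alpha + 1) beta gamma a) /\
      interlaces `]-oo, +oo[
        (angelesco_jacobi n (alpha + 1) beta gamma a)
        (angelesco_jacobi n alpha beta gamma a),
      interlaces `]-oo, +oo[
        (angelesco_jacobi n alpha beta gamma a)
        (angelesco_jacobi n alpha (beta + 1) gamma a) /\
      interlaces `]-oo, +oo[
        (angelesco_jacobi n alpha (beta + 1) gamma a)
        ('X * ('X - 1%:P)
           * angelesco_jacobi n.-1 (alpha + 1) (beta + 1) (gamma + 1) a),
      interlaces `]a, 0[
        (angelesco_jacobi n alpha beta (gamma + 1) a)
        (angelesco_jacobi n alpha beta gamma a) /\
      interlaces `]a, 0[
        (angelesco_jacobi n alpha beta gamma a)
        (angelesco_jacobi n.-1 (alpha + 1) (beta + 1) (gamma + 1) a) &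
      interlaces `]0, 1[
        (angelesco_jacobi n alpha beta gamma a)
        (angelesco_jacobi n alpha beta (gamma + 1) a) /\
      interlaces `]0, 1[
        (angelesco_jacobi n alpha beta (gamma + 1) a)
        (angelesco_jacobi n.-1 (alpha + 1) (beta + 1) (gamma + 1) a)].
Proof.
case: n hn => [//|N] _ /=.
have [al2 be2 ga2] : [/\ -1 < alpha + 1, -1 < beta + 1 & -1 < gamma + 1] by split; lra.
have [l [m [[sl sm] ltl ltm [lI mI] rE]]] := angelesco_jacobi_zeros ha N al2 be2 ga2.
have pos := rodrigues_sign ha halpha hbeta hgamma sl sm ltl ltm lI mI rE
  (angelesco_jacobi_rodrigues ha N halpha hbeta hgamma).
have sz := node_list_sorted ha ltl ltm lI mI.
have [pm ps _ _] := angelesco_jacobi_spec ha N.+1 halpha hbeta hgamma.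
have [|t gt tE] := alternating_roots pm _ (same_sign_alternating sz pos) sz.
  by rewrite ps (size_node_list a sl sm).
have st : size t = (2 * N.+1)%N.
  by case: (gt) => + _; rewrite (size_node_list a sl sm) => -[].
have size2 b c : size (('X - b%:P) * ('X - c%:P) : {poly R}) = 3.
  by rewrite size_Mmonic ?monicXsubC ?monic_neq0 ?monicXsubC// !size_XsubC.
have monic2 b c : ('X - b%:P) * ('X - c%:P) \is @monic R by rewrite monicMl ?monicXsubC.
have n1E : aj_nodes a = ('X - 1%:P) * (('X - 0%:P) * ('X - a%:P)).
  by rewrite /aj_nodes subr0; ring.
have naE : aj_nodes a = ('X - a%:P) * (('X - 0%:P) * ('X - 1%:P)).
  by rewrite /aj_nodes subr0; ring.
have n0E : aj_nodes a = ('X - 0%:P) * (('X - a%:P) * ('X - 1%:P)).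
  by rewrite /aj_nodes subr0; ring.
(* Raising [alpha], [beta] or [gamma] corresponds to [b] equal to [1], [a] or [0]. *)
have [v1 [gv1 v1E cmp1]] := shifted_jacobi_zeros ha halpha hbeta hgamma al2 hbeta hgamma
  (fun c d acd => aj_int_shift1 ha acd halpha hbeta hgamma)
  n1E
  (monic2 0 a) (size2 0 a) sl sm ltl ltm lI mI rE gt tE.
have [va [gva vaE cmpa]] := shifted_jacobi_zeros ha halpha hbeta hgamma halpha be2 hgamma
  (fun c d acd => aj_int_shifta ha acd halpha hbeta hgamma)
  naE
  (monic2 0 1) (size2 0 1) sl sm ltl ltm lI mI rE gt tE.
have [v0 [gv0 v0E cmp0]] := shifted_jacobi_zeros ha halpha hbeta hgamma halpha hbeta ga2
  (fun c d acd => aj_int_shift0 ha acd halpha hbeta hgamma)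
  n0E
  (monic2 a 1) (size2 a 1) sl sm ltl ltm lI mI rE gt tE.
rewrite rE tE v1E vaE v0E.
have [N1 _ _ _] := interlaces_node ha sl sm ltl ltm lI mI gv1.
have [_ N2 _ _] := interlaces_node ha sl sm ltl ltm lI mI gva.
have [_ _ N3 _] := interlaces_node ha sl sm ltl ltm lI mI gt.
have [_ _ _ N4] := interlaces_node ha sl sm ltl ltm lI mI gv0.
have t_node k i := @gaps_nodeP _ _ _ _ ha ltl ltm lI mI t k i gt.
(* The position of each zero relative to [b] gives its direction: raising [alpha] moves every zero
   to the left, raising [beta] to the right, and raising [gamma] away from [0]. *)
have t_gt_a i : (i < 2 * N.+1)%N -> a < t`_i.
  by rewrite -st => it; have [->] := t_node 0 i it isT.
have t_lt_1 i : (i < 2 * N.+1)%N -> t`_i < 1.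
  rewrite -st => it; have [_] := t_node _ i it (leqnn _).
  by rewrite st (node_list_last a sl sm) -st it.
have t_zero i : (i < 2 * N.+1)%N ->
    (0 < t`_i) = (N < i)%N /\ (t`_i < 0) = (i < N.+1)%N.
  rewrite -st => it; have [|] := t_node N.+1 i it; first by rewrite st; lia.
  by rewrite (node_list_mid a _ sl).
have [v1t _] := interlaces_gaps_node ha sl sm ltl ltm lI mI gv1 gt.
split; split.
- exact: N1.
- by apply: v1t => i /[dup] iN /cmp1[_]; apply; exact: t_lt_1.
- have [tva _] := interlaces_gaps_node ha sl sm ltl ltm lI mI gt gva.
  by apply: tva => i /[dup] iN /cmpa[+ _]; apply; exact: t_gt_a.
- exact: N2.
- have [_ [v0t _]] := interlaces_gaps_node ha sl sm ltl ltm lI mI gv0 gt.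
  apply: v0t => i iN; have iN2 : (i < 2 * N.+1)%N by lia.
  by apply: (cmp0 i iN2).2; rewrite (t_zero i iN2).2.
- exact: N3.
- have [_ [_ tv0]] := interlaces_gaps_node ha sl sm ltl ltm lI mI gt gv0.
  apply: tv0 => i iN; have iN2 : (N.+1 + i < 2 * N.+1)%N by lia.
  by apply: (cmp0 _ iN2).1; rewrite (t_zero _ iN2).1; lia.
- exact: N4.
Qed.
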